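(* Let $m$ be a positive integer, let $r,s$ be parameters (constants independent of $t$), and let $'$ denote $\frac{d}{dt}$. Put $$W(r,m,s)=\sum_{j=0}^m(-1)^j\binom{r+m+1-j}{m-j}\binom{s+m}{j}t^{m-j}.$$ Let $T_1=1$, $T_2=W(r,m,s)$, $S_1=1$, $S_2=W(r-1,m+1,s-1)$, and for $n\ge 2$ define $T_{n+1}$ and $S_{n+1}$ recursively by $$T_{n+1}T_{n-1}=(t^2-t)\bigl(T_nT_n''-(T_n')^2\bigr)+(2t-1)T_nT_n'+(n-1)(n+r)T_n^2,$$ $$S_{n+1}S_{n-1}=(t^2-t)\bigl(S_nS_n''-(S_n')^2\bigr)+(2t-1)S_nS_n'+(n-1)(n+r-1)S_n^2.$$ Then the $T_n$ and $S_n$ are polynomials in $t$, and for every positive integer $n$ the function $$q_n=t+\frac{t(t-1)}{n+r}\left\{\frac{S_n'}{S_n}-\frac{T_{n+1}'}{T_{n+1}}-\frac{n+s-1}{t}-\frac{n+r-m-s}{t-1}\right\}$$ satisfies the sixth Painlev\'e equation $$P_{VI}\left(\frac{(n+r)^2}{2},\,-\frac{(m+s)^2}{2},\,\frac{(r-s+1)^2}{2},\,\frac{1-(n+m)^2}{2}\right).$$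
   Context: $P_{VI}(\alpha,\beta,\gamma,\delta)$ denotes the differential equation $$q''=\frac12\left(\frac1q+\frac1{q-1}+\frac1{q-t}\right)(q')^2-\left(\frac1t+\frac1{t-1}+\frac1{q-t}\right)q'+\frac{q(q-1)(q-t)}{t^2(t-1)^2}\left(\alpha+\frac{\beta t}{q^2}+\frac{\gamma(t-1)}{(q-1)^2}+\frac{\delta t(t-1)}{(q-t)^2}\right)$$ for $q=q(t)$. Binomial coefficients are $\binom{x}{k}=x(x-1)\cdots(x-k+1)/k!$ for a nonnegative integer $k$ and arbitrary $x$. $W(r-1,m+1,s-1)$ means the formula for $W$ with $r,m,s$ replaced by $r-1,m+1,s-1$.
   Formalization: Added for each n: n+r≠0, S_n≠0, T_{n+1}≠0 (so that q_n is defined; the last two are automatic if k+r≠0 for all k≥1), and m+s≠0, r−s+1≠0, since otherwise q_n is identically 0 or 1 and P_VI has zero denominators. *)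

(* Defs.v *)
From HB Require Import structures.
From mathcomp Require Import all_boot all_order all_algebra.
From mathcomp Require Import ring.
Set Implicit Arguments.
Unset Strict Implicit.
Unset Printing Implicit Defensive.
Import GRing.Theory.
Local Open Scope ring_scope.

Notation "p %:F" := (@FracField.tofrac _ p) : ring_scope.

Section RationalFunctions.
Variable F : fieldType.

(* F(t), the field of rational functions over the field of constants F *)
Local Notation ratfun := {fraction {poly F}}.

Definition tvar : ratfun := ('X : {poly F})%:F.

Definition cst (c : F) : ratfun := (c%:P)%:F.

(* d/dt on F(t), by the quotient rule on a chosen representative n/d;
   derivF_div below shows that the choice is irrelevant. *)
Definition derivF (x : ratfun) : ratfun :=
  let n := \n_(repr x) in
  let d := \d_(repr x) in
  (n^`() * d - n * d^`())%:F / (d ^+ 2)%:F.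

Lemma derivF_div (p q : {poly F}) : q != 0 ->
  derivF (p%:F / q%:F) = (p^`() * q - p * q^`())%:F / (q ^+ 2)%:F.
Proof.
move=> q0; rewrite /derivF; set x : ratfun := p%:F / q%:F.
have d0 : \d_(repr x) != 0 by exact: denom_ratioP.
have Ex : x = (\n_(repr x))%:F / (\d_(repr x))%:F.
  apply: (@mulIf _ (\d_(repr x))%:F); first by rewrite tofrac_eq0.
  rewrite divfK ?tofrac_eq0 // -{1}[x]reprK.
  unlock FracField.tofrac; rewrite -[LHS]FracField.pi_mul.
  apply/eqmodP; rewrite /= FracField.equivfE /FracField.mulf.
  rewrite !numden_Ratio ?mulf_neq0 ?oner_neq0 //.
  by apply/eqP; ring.
move: (\n_(repr x)) (\d_(repr x)) d0 Ex => n d d0 Ex; rewrite {}/x in Ex.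
have qF : q%:F != 0 :> ratfun by rewrite tofrac_eq0.
have dF : d%:F != 0 :> ratfun by rewrite tofrac_eq0.
have E : p * d = n * q.
  have H : p%:F * d%:F = n%:F * q%:F :> ratfun.
    have /(congr1 (fun z => z * (q%:F * d%:F))) := Ex.
    by rewrite mulrA (mulfVK qF) [q%:F * _]mulrC mulrA (mulfVK dF).
  by move: H; rewrite -(tofracM p d) -(tofracM n q) => /eqP;
    rewrite tofrac_eq => /eqP.
have E' : p^`() * d + p * d^`() = n^`() * q + n * q^`() by rewrite -!derivM E.
apply/eqP; rewrite eqr_div ?tofrac_eq0 ?expf_neq0 //.
rewrite -(tofracM (n^`() * d - n * d^`())).
rewrite -(tofracM (p^`() * q - p * q^`())) tofrac_eq.
apply/eqP; move: (p^`()) (q^`()) (n^`()) (d^`()) E' => p' q' n' d' E'.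
have -> : (n' * d - n * d') * q ^+ 2
  = d * q * (n' * q + n * q') - d * q' * (n * q) - q * d' * (n * q) by ring.
by rewrite -E' -E; ring.
Qed.

(* x (x - 1) ... (x - k + 1) / k! *)
Definition gbinom (x : F) (k : nat) : F :=
  (\prod_(i < k) (x - i%:R)) / (k`!)%:R.

Definition W (r : F) (m : nat) (s : F) : {poly F} :=
  \sum_(j < m.+1)
    ((-1) ^+ j * gbinom (r + m%:R + 1 - j%:R) (m - j) * gbinom (s + m%:R) j)
      *: 'X^(m - j).

(* Right-hand side of the recursions: n + a is n + r for T and n + r - 1 for S *)
Definition toda_rhs (a : F) (n : nat) (x : ratfun) : ratfun :=
  let x' := derivF x in
  let x'' := derivF x' in
  (tvar ^+ 2 - tvar) * (x * x'' - x' ^+ 2) + (2 * tvar - 1) * x * x'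
  + cst ((n%:R - 1) * (n%:R + a)) * x ^+ 2.

(* x_1 = 1, x_2 = w, x_(n+1) = toda_rhs a n x_n / x_(n-1) for n >= 2, in F(t);
   index 0 is unused.  As y / 0 = 0 in a fieldType, once a term vanishes
   identically (possible for exceptional r, s only) so do all later ones. *)
Fixpoint toda_seq (a : F) (w : ratfun) (n : nat) : ratfun :=
  match n with
  | 0 => 0
  | 1 => 1
  | 2 => w
  | ((k.+1 as n2).+1 as n1).+1 =>
      toda_rhs a n1 (toda_seq a w n1) / toda_seq a w n2
  end.

Definition Tn (r : F) (m : nat) (s : F) : nat -> ratfun :=
  toda_seq r (W r m s)%:F.

Definition Sn (r : F) (m : nat) (s : F) : nat -> ratfun :=
  toda_seq (r - 1) (W (r - 1) m.+1 (s - 1))%:F.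

Definition qfun (r : F) (m : nat) (s : F) (n : nat) : ratfun :=
  tvar + tvar * (tvar - 1) / cst (n%:R + r) *
    (derivF (Sn r m s n) / Sn r m s n
     - derivF (Tn r m s n.+1) / Tn r m s n.+1
     - cst (n%:R + s - 1) / tvar
     - cst (n%:R + r - m%:R - s) / (tvar - 1)).

Definition is_polynomial (x : ratfun) : Prop := exists p : {poly F}, x = p%:F.

(* q solves P_VI(alpha, beta, gamma, delta); the equation only makes sense when
   q is none of 0, 1, t, which is made part of the definition.  This matters:
   qfun r m s n is identically 0 when m + s = 0, and 1 when r - s + 1 = 0. *)
Definition solves_PVI (alpha beta gamma delta : F) (q : ratfun) : Prop :=
  let t := tvar in
  let q' := derivF q in
  let q'' := derivF q' in
  [/\ q != 0, q != 1, q != t &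
    q'' = 1 / 2 * (1 / q + 1 / (q - 1) + 1 / (q - t)) * q' ^+ 2
          - (1 / t + 1 / (t - 1) + 1 / (q - t)) * q'
          + q * (q - 1) * (q - t) / (t ^+ 2 * (t - 1) ^+ 2)
            * (cst alpha + cst beta * t / q ^+ 2
               + cst gamma * (t - 1) / (q - 1) ^+ 2
               + cst delta * t * (t - 1) / (q - t) ^+ 2)].

End RationalFunctions.

(* Main.v *)
(* Let D = t(t-1) d/dt and u = t(t-1).  As D^2 log u = 2u, the recursion is the
   Toda equation for the functions u^((n-1)(n+a)/2) x_n; its solution with
   x_1 = 1 is a determinant of iterated derivatives of x_2, from which the right
   power of u can be divided out, and this gives polynomiality.  Comparing top
   coefficients in the recursion gives deg T_n = (n-1)m, hence nonvanishing.

   For P_VI, complete q = q_n by a momentum p to a solution of the Hamiltonian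
   system with a_0 = n+m, a_1 = n+r, a_2 = 1-n, a_3 = s-r-1, a_4 = -m-s.  The
   logarithmic derivatives of T_n, T_(n+1) and S_n are then polynomials in q, p
   and t, and raising n by one is a translation in the affine Weyl group of
   Backlund transformations, whose effect on these logarithmic derivatives is
   exactly the Toda recursion.  For n = 1 one has p = 0 and q is a Riccati
   solution, by the contiguity relations of the hypergeometric polynomial W. *)

Require Import Defs.
From HB Require Import structures.
From mathcomp Require Import all_boot all_order all_algebra.
From mathcomp Require Import perm ring.
Set Implicit Arguments.
Unset Strict Implicit.
Unset Printing Implicit Defensive.
Import GRing.Theory.
Local Open Scope ring_scope.

(** * Backlund transformations of the Hamiltonian system *)

Section Derivation.
Variables (K : fieldType) (D : K -> K).
Hypothesis DD : forall x y, D (x + y) = D x + D y.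
Hypothesis DM : forall x y, D (x * y) = D x * y + x * D y.

Lemma der0 : D 0 = 0.
Proof. by apply: (@addrI _ (D 0)); rewrite -DD !addr0. Qed.

Lemma der1 : D 1 = 0.
Proof.
have := DM 1 1; rewrite !mulr1 mul1r => /eqP.
by rewrite -subr_eq0 opprD addNKr oppr_eq0 => /eqP.
Qed.

Lemma derN x : D (- x) = - D x.
Proof. by apply/eqP; rewrite -addr_eq0 -DD addNr der0. Qed.

Lemma derV x : D x^-1 = - D x / x ^+ 2.
Proof.
have [->|x0] := eqVneq x 0; first by rewrite invr0 der0 oppr0 mul0r.
have := DM x x^-1; rewrite divff // der1 => /esym E.
apply: (mulfI x0); apply: (@addrI _ (D x * x^-1)); rewrite E.
by field.
Qed.

Lemma der_nat n : D n%:R = 0.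
Proof. by elim: n => [|n IH]; rewrite ?der0 // -addn1 natrD DD IH der1 addr0. Qed.

Variable t : K.
Hypothesis Dt : D t = t * (t - 1).
Hypotheses (t0 : t != 0) (t1 : t != 1).

(* Hamilton's equations of P_VI for the derivation D = t(t-1) d/dt.  The parameter
   a1 is eliminated by a0 + a1 + 2 a2 + a3 + a4 = 1; a0, a1, a3, a4 belong to the
   points q = t, oo, 1, 0, and ham is the Hamiltonian. *)
Definition ham_sys (a0 a2 a3 a4 q p : K) : Prop :=
  D q = 2 * (q * (q - 1) * (q - t)) * p
        - ((a0 - 1) * q * (q - 1) + a3 * q * (q - t) + a4 * (q - 1) * (q - t))
  /\ D p = - (((q - 1) * (q - t) + q * (q - t) + q * (q - 1)) * p ^+ 2
        - ((a0 - 1) * (2 * q - 1) + a3 * (2 * q - t) + a4 * (2 * q - 1 - t)) * p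
        + a2 * (1 - a0 - a2 - a3 - a4)).

Definition ham (a0 a2 a3 a4 q p : K) : K :=
  q * (q - 1) * (q - t) * p ^+ 2
  - ((a0 - 1) * q * (q - 1) + a3 * q * (q - t) + a4 * (q - 1) * (q - t)) * p
  + a2 * (1 - a0 - a2 - a3 - a4) * (q - t).

Ltac dsimp := rewrite !(DM, derV, derN, DD, der1, der_nat, Dt).

Lemma ham_sys_eq a0 a2 a3 a4 q p b0 b2 b3 b4 q' p' :
  a0 = b0 -> a2 = b2 -> a3 = b3 -> a4 = b4 -> q = q' -> p = p' ->
  ham_sys a0 a2 a3 a4 q p -> ham_sys b0 b2 b3 b4 q' p'.
Proof. by do 6!move->. Qed.

(* s0, ..., s4 generate the affine Weyl group of type D4, and sigma is the diagram
   automorphism exchanging 0 with 1 and 3 with 4. *)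
Lemma ham_sys_s2 a0 a2 a3 a4 q p : D a2 = 0 -> p != 0 ->
  ham_sys a0 a2 a3 a4 q p ->
  ham_sys (a0 + a2) (- a2) (a3 + a2) (a4 + a2) (q + a2 / p) p.
Proof.
move=> Da p0 [Eq Ep]; split; last by rewrite Ep; field.
by dsimp; rewrite Da Eq Ep; field.
Qed.

(** The system contains [a2] only in its product with [a1 + a2], and s1 exchanges these two
    factors. *)
Lemma ham_sys_s1 a0 a2 a3 a4 q p :
  ham_sys a0 a2 a3 a4 q p -> ham_sys a0 (1 - a0 - a2 - a3 - a4) a3 a4 q p.
Proof. by case=> Eq Ep; split=> //; rewrite Ep; ring. Qed.

Lemma ham_sys_s0 a0 a2 a3 a4 q p : D a0 = 0 -> q != t ->
  ham_sys a0 a2 a3 a4 q p ->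
  ham_sys (- a0) (a2 + a0) a3 a4 q (p - a0 / (q - t)).
Proof.
rewrite -[q == t]subr_eq0 => Da qt [Eq Ep]; split; first by rewrite Eq; field.
by dsimp; rewrite Da Eq Ep; field.
Qed.

Lemma ham_sys_s3 a0 a2 a3 a4 q p : D a3 = 0 -> q != 1 ->
  ham_sys a0 a2 a3 a4 q p ->
  ham_sys a0 (a2 + a3) (- a3) a4 q (p - a3 / (q - 1)).
Proof.
rewrite -[q == 1]subr_eq0 => Da qt [Eq Ep]; split; first by rewrite Eq; field.
by dsimp; rewrite Da Eq Ep; field.
Qed.

Lemma ham_sys_s4 a0 a2 a3 a4 q p : D a4 = 0 -> q != 0 ->
  ham_sys a0 a2 a3 a4 q p ->
  ham_sys a0 (a2 + a4) a3 (- a4) q (p - a4 / q).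
Proof.
move=> Da qt [Eq Ep]; split; first by rewrite Eq; field.
by dsimp; rewrite Da Eq Ep; field.
Qed.

Lemma ham_sys_sigma a0 a2 a3 a4 q p : D a2 = 0 -> q != t ->
  ham_sys a0 a2 a3 a4 q p ->
  ham_sys (1 - a0 - 2 * a2 - a3 - a4) a2 a4 a3 (t * (q - 1) / (q - t))
    (- (q - t) * ((q - t) * p + a2) / (t * (t - 1))).
Proof.
move: t1; rewrite -[t == 1]subr_eq0 -[q == t]subr_eq0 => t1' Da qt [Eq Ep].
by split; dsimp; rewrite ?Da ?Ep Eq; field; rewrite ?qt ?t0 ?t1'.
Qed.

(** At [q = 0] the first equation reduces to [a4 * t = 0]. The next two lemmas argue likewise at
    [q = 1] and [q = t]; in the last, [D t] turns [a0 - 1] into [a0]. *)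
Lemma ham_sys_neq0 a0 a2 a3 a4 q p :
  ham_sys a0 a2 a3 a4 q p -> a4 != 0 -> q != 0.
Proof.
move=> [Eq _] a40; apply/eqP => q0; move: Eq; rewrite q0 der0 => /esym E.
suff /eqP : a4 * t = 0 by rewrite mulf_eq0 (negPf a40) (negPf t0).
by rewrite -[RHS]oppr0 -E; ring.
Qed.

Lemma ham_sys_neq1 a0 a2 a3 a4 q p :
  ham_sys a0 a2 a3 a4 q p -> a3 != 0 -> q != 1.
Proof.
move=> [Eq _] a40; apply/eqP => q0; move: Eq; rewrite q0 der1 => /esym E.
suff /eqP : a3 * (t - 1) = 0.
  by rewrite mulf_eq0 (negPf a40) subr_eq0 (negPf t1).
by rewrite -E; ring.
Qed.

Lemma ham_sys_neqt a0 a2 a3 a4 q p :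
  ham_sys a0 a2 a3 a4 q p -> a0 != 0 -> q != t.
Proof.
move=> [Eq _] a40; apply/eqP => q0; move: Eq; rewrite q0 Dt => /esym E.
suff /eqP : a0 * (t * (t - 1)) = 0.
  by rewrite !mulf_eq0 (negPf a40) (negPf t0) subr_eq0 (negPf t1).
have -> : a0 * (t * (t - 1)) = t * (t - 1) - t * (t - 1) + a0 * (t * (t - 1)) by ring.
by rewrite -{1}E; ring.
Qed.

(* Numerators of the composite s2 s3 s4 s2, see ham_sys_shift: unlike its factors,
   the composite remains defined when p = 0. *)
Definition shift_A (a2 q p : K) := q * p + a2.
Definition shift_B (a2 q p : K) := (q - 1) * p + a2.
Definition shift_G (a2 a3 a4 q p : K) :=
  shift_A a2 q p * shift_B a2 q p - (a3 + a2) * shift_A a2 q p - (a4 + a2) * shift_B a2 q p.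

(** For [p != 0] the two numerators are [p] times [x] and [x - 1], where [x] is the coordinate after
    s2. The value [x = 0] forces [a4 + a2 = 0], and [x = 1] forces [a3 + a2 = 0]; in both cases
    [shift_G] would vanish. *)
Lemma shift_AB_neq0 a0 a2 a3 a4 q p : D a2 = 0 ->
  ham_sys a0 a2 a3 a4 q p -> shift_G a2 a3 a4 q p != 0 ->
  shift_A a2 q p != 0 /\ shift_B a2 q p != 0.
Proof.
move=> Da E; have [->|p0] := eqVneq p 0.
  rewrite /shift_G /shift_A /shift_B !mulr0 !add0r => G0.
  have a20 : a2 != 0 by apply: contraNneq G0 => ->; rewrite !mulr0 !subr0.
  by [].
have E2 := ham_sys_s2 Da p0 E; rewrite /shift_G => G0.
split; apply: contraNneq G0 => H0; rewrite H0.
  have x0 : q + a2 / p = 0 by rewrite -[RHS](mul0r p^-1) -H0 /shift_A; field.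
  have [->|/(ham_sys_neq0 E2)] := eqVneq (a4 + a2) 0; first by rewrite !mul0r mulr0 !subr0.
  by rewrite x0 eqxx.
have x1 : q + a2 / p = 1.
  by rewrite -[RHS]addr0 -(mul0r p^-1) -H0 /shift_B; field.
have [->|/(ham_sys_neq1 E2)] := eqVneq (a3 + a2) 0.
  by rewrite !mul0r !mulr0 !subr0.
by rewrite x1 eqxx.
Qed.

(** The reflections s2, s3, s4 move the Hamiltonian only by a polynomial of degree at most one in
    [t]; [ham_sys_shift] adds these up. *)
Lemma ham_s2 a0 a2 a3 a4 q p : p != 0 ->
  ham (a0 + a2) (- a2) (a3 + a2) (a4 + a2) (q + a2 / p) p
  = ham a0 a2 a3 a4 q p
    + a2 * ((2 - 2 * a0 - 2 * a2 - a3 - a4) * t + a0 + a2 + a4 - 1).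
Proof. by move=> p0; rewrite /ham; field. Qed.

Lemma ham_s3 a0 a2 a3 a4 q p : q != 1 ->
  ham a0 (a2 + a3) (- a3) a4 q (p - a3 / (q - 1))
  = ham a0 a2 a3 a4 q p + (a0 - 1) * a3 * t.
Proof. by rewrite -subr_eq0 => q1; rewrite /ham; field. Qed.

Lemma ham_s4 a0 a2 a3 a4 q p : q != 0 ->
  ham a0 (a2 + a4) a3 (- a4) q (p - a4 / q)
  = ham a0 a2 a3 a4 q p + (a0 - 1) * a4 * (t - 1).
Proof. by move=> q1; rewrite /ham; field. Qed.

Lemma ham_sys_shift a0 a2 a3 a4 q p :
  D a2 = 0 -> D a3 = 0 -> D a4 = 0 ->
  ham_sys a0 a2 a3 a4 q p -> shift_G a2 a3 a4 q p != 0 ->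
  ham_sys (a0 + 2 * a2 + a3 + a4) (- (a2 + a3 + a4)) a4 a3
    (shift_A a2 q p * ((q - 1) * shift_A a2 q p - a3) / shift_G a2 a3 a4 q p)
    (p * shift_G a2 a3 a4 q p / (shift_A a2 q p * shift_B a2 q p)) /\
  ham (a0 + 2 * a2 + a3 + a4) (- (a2 + a3 + a4)) a4 a3
    (shift_A a2 q p * ((q - 1) * shift_A a2 q p - a3) / shift_G a2 a3 a4 q p)
    (p * shift_G a2 a3 a4 q p / (shift_A a2 q p * shift_B a2 q p))
  = ham a0 a2 a3 a4 q p
    + (1 - a0 - a2 - a3 - a4) * ((2 * a2 + a3 + a4) * t - a2 - a3).
Proof.
move=> Da2 Da3 Da4 E G0; have [A0 B0] := shift_AB_neq0 Da2 E G0.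
(* For [p = 0] the factor s2 is undefined, but the second equation gives
   [a2 * (1 - a0 - a2 - a3 - a4) = 0] with [a2 != 0], so the other factor vanishes and the claims
   are checked directly. *)
have [p0|p0] := eqVneq p 0.
  move: E G0 A0 B0; rewrite p0 /shift_G /shift_A /shift_B !mulr0 !add0r !mul0r.
  move=> [Eq Ep] G0 a20 _.
  have c0 : a2 + a3 + a4 != 0.
    apply: contraNneq G0 => c0; apply/eqP.
    by transitivity (- a2 * (a2 + a3 + a4)); [ring|rewrite c0 mulr0].
  have h0 : a2 * (1 - a0 - a2 - a3 - a4) = 0.
    by move: Ep; rewrite der0 => /esym/eqP; rewrite mulr0 expr0n mulr0 subr0 add0r oppr_eq0 => /eqP.
  have {}h0 : 1 - a0 - a2 - a3 - a4 = 0 by apply: (mulfI a20); rewrite h0 mulr0.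
  have ea0 : a0 = 1 - a2 - a3 - a4 by rewrite -[RHS]subr0 -h0; ring.
  have -> : a2 * ((q - 1) * a2 - a3) / (a2 * a2 - (a3 + a2) * a2 - (a4 + a2) * a2)
    = - ((q - 1) * a2 - a3) / (a2 + a3 + a4).
    have -> : a2 * a2 - (a3 + a2) * a2 - (a4 + a2) * a2 = - (a2 * (a2 + a3 + a4)) by ring.
    by field; rewrite c0 oppr_eq0 mulf_neq0.
  split; first split; last 2 first.
  - by rewrite der0 ea0; ring.
  - by rewrite /ham ea0; field.
  by dsimp; rewrite Da2 Da3 Da4 Eq ea0 !mulr0; field.
have E1 := ham_sys_s2 Da2 p0 E.
have x0 : q + a2 / p != 0.
  by apply: contraNneq A0 => x0; rewrite -[X in _ == X](mul0r p) -x0 /shift_A; apply/eqP; field.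
have x1 : q + a2 / p != 1.
  apply: contraNneq B0 => /eqP; rewrite -subr_eq0 => /eqP x1.
  by rewrite -[X in _ == X](mul0r p) -x1 /shift_B; apply/eqP; field.
have Dc3 : D (a3 + a2) = 0 by rewrite DD Da3 Da2 addr0.
have Dc4 : D (a4 + a2) = 0 by rewrite DD Da4 Da2 addr0.
have E2 := ham_sys_s4 Dc4 x0 (ham_sys_s3 Dc3 x1 E1).
set p2 := (X in ham_sys _ _ _ _ _ X) in E2.
have Ep2 : p2 = p * shift_G a2 a3 a4 q p / (shift_A a2 q p * shift_B a2 q p).
  rewrite /p2 /shift_G; move: A0 B0; rewrite /shift_A /shift_B => A0 B0.
  by field; rewrite p0 ?A0 ?B0.
have p20 : p2 != 0 by rewrite Ep2 !mulf_neq0 ?invr_neq0 ?mulf_neq0.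
have Dc2 : D (- a2 + (a3 + a2) + (a4 + a2)) = 0 by rewrite !(DD, derN) Da2 Da3 Da4; ring.
have E3 := ham_sys_s2 Dc2 p20 E2.
have H3 := ham_s2 (a0 + a2) (- a2 + (a3 + a2) + (a4 + a2)) (- (a3 + a2)) (- (a4 + a2))
  (q + a2 / p) p20.
have Eq3 : q + a2 / p + (- a2 + (a3 + a2) + (a4 + a2)) / p2 =
   shift_A a2 q p * ((q - 1) * shift_A a2 q p - a3) / shift_G a2 a3 a4 q p.
  rewrite Ep2; move: G0 A0 B0; rewrite /shift_G.
  set A := shift_A _ _ _; set B := shift_B _ _ _ => G0 A0 B0.
  have -> : A * ((q - 1) * A - a3) =
      A * (A * B - (a3 + a2) * A - (a4 + a2) * B + (a2 + a3 + a4) * B) / p.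
    by rewrite /A /B /shift_A /shift_B; field.
  have -> : q + a2 / p = A / p by rewrite /A /shift_A; field.
  by field; rewrite p0 A0 B0 G0.
rewrite -Ep2 -Eq3; split; first by apply: ham_sys_eq E3; try ring.
apply: (etrans (etrans _ H3)); first by congr ham; ring.
by rewrite /p2 ham_s4 // ham_s3 // ham_s2 //; ring.
Qed.

Definition logder (x : K) := D x / x.

(** * The step from n to n + 1, in two halves *)

Section Step.
Variables (n m r s : K).
Hypotheses (Dn : D n = 0) (Dm : D m = 0) (Dr : D r = 0) (Ds : D s = 0).

Ltac csimp := dsimp; rewrite ?(Dn, Dm, Dr, Ds).

(* T1, T2, S1, S2 stand for T_n, T_(n+1), S_n, S_(n+1).  The equation for S1
   says that q is q_n, but it remains meaningful when a1 = n + r vanishes. *)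
Definition pvi_state (T1 T2 S1 S2 q p : K) : Prop :=
  [/\ ham_sys (n + m) (1 - n) (s - r - 1) (- m - s) q p,
    logder T1 = ham (n + m) (1 - n) (s - r - 1) (- m - s) q p
              + (n - 1) * (s + (m - 1 - r) * t),
    logder T2 = ham (n + m) (1 - n) (s - r - 1) (- m - s) q p
              - q * (q - 1) * p - (r + 1) * (q - t)
              + n * (s + (m - 1 - r) * t),
    logder S1 = logder T2 + (n + r) * (q - t) + (n + s - 1) * (t - 1)
              + (n + r - m - s) * t
  & (m + 1) * (S2 * T1) = - ((r + 1) * ((q - t) * (S1 * T2)))].

(* The image of pvi_state under sigma s1 s0, that is, half of the step from n to
   n + 1. *)
Definition half_state (T1 T2 S1 S2 q p : K) : Prop :=
  [/\ ham_sys (- n - r) (r + m + n + 1) (- m - s) (s - r - 1) q p,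
    logder T2 = ham (- n - r) (r + m + n + 1) (- m - s) (s - r - 1) q p
              + (r + n + 1) * ((r + m + 1) * t + s - r - 1),
    logder T1 = ham (- n - r) (r + m + n + 1) (- m - s) (s - r - 1) q p
              - q * (q - 1) * p - (r + 1) * (q - t)
              + (r + n) * ((r + m + 1) * t + s - r - 1),
    logder S2 = ham (- n - r) (r + m + n + 1) (- m - s) (s - r - 1) q p
              - q * (q - 1) * p - (r + m + n + 1) * (q - t)
              + (r + n) * ((r + m + 1) * t + s - r - 1)
  & (m + 1) * ((q - t) * (S2 * T1)) = - ((r + 1) * (t * (t - 1) * (S1 * T2)))].

(** The new coordinates come from s0, s1 and sigma in turn. The product relation makes [S2] a
    constant multiple of [(q - t) * S1 * T2 / T1], whose logarithmic derivative gives the clause for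
    [S2]. *)
Lemma pvi_state_half (T1 T2 S1 S2 q p : K) :
  T1 != 0 -> T2 != 0 -> S1 != 0 -> m + 1 != 0 -> r + 1 != 0 -> q != t ->
  pvi_state T1 T2 S1 S2 q p ->
  half_state T1 T2 S1 S2 (t * (q - 1) / (q - t))
    (- (q - t) * ((q - t) * (p - (n + m) / (q - t)) + (r + m + n + 1)) / (t * (t - 1))).
Proof.
move=> T10 T20 S10 m0 r0 qt [E ET1 ET2 ES1 EST].
have t1' : t - 1 != 0 by rewrite subr_eq0.
have qt' : q - t != 0 by rewrite subr_eq0.
have E1 : ham_sys (- n - r) (r + m + n + 1) (- m - s) (s - r - 1)
    (t * (q - 1) / (q - t))
    (- (q - t) * ((q - t) * (p - (n + m) / (q - t)) + (r + m + n + 1)) / (t * (t - 1))).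
  have Da0 : D (n + m) = 0 by rewrite DD Dn Dm addr0.
  have := ham_sys_s1 (ham_sys_s0 Da0 qt E).
  move=> /ham_sys_sigma => /(_ _ qt) H; apply: (ham_sys_eq _ _ _ _ _ _ (H _)); try ring.
  by csimp; ring.
have S2E : S2 = - (r + 1) / (m + 1) * ((q - t) * ((S1 * T2) / T1)).
  by apply: (mulfI m0); apply: (mulIf T10); rewrite -mulrA EST; field; rewrite T10 m0.
split=> //.
- by rewrite ET2 /ham; field; rewrite qt' t0 t1'.
- by rewrite ET1 /ham; field; rewrite qt' t0 t1'.
- have -> : logder S2 = D (q - t) / (q - t) + logder S1 + logder T2 - logder T1.
    rewrite S2E /logder; csimp; field.
    by rewrite T10 T20 S10 oppr_eq0 r0 m0 qt'.
  rewrite ES1 ET2 ET1 /ham. csimp. case: E => -> _.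
  by field; rewrite qt' t0 t1'.
- by rewrite mulrCA EST; field; exact: qt'.
Qed.

(** The first Toda expression is minus the denominator of the shifted [q] of [ham_sys_shift]; the
    second contains the shifted [q] minus [t]. Together the two recursions therefore reproduce the
    product relation at the next index. *)
Lemma half_state_toda T1 T2 S1 S2 q p :
  let b2 := r + m + n + 1 in
  let A := shift_A b2 q p in
  let G := shift_G b2 (- m - s) (s - r - 1) q p in
  half_state T1 T2 S1 S2 q p ->
  D (logder T2) / (t * (t - 1)) + n * (n + 1 + r) = - G /\
  (G != 0 ->
   D (logder S2) / (t * (t - 1)) + n * (n + r)
   = - G * (q - t) / (t * (t - 1)) * (A * ((q - 1) * A - (- m - s)) / G - t)).
Proof.
move=> b2 A G [[Eq Ep] ET2 ET1 ES2 EST].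
have t1' : t - 1 != 0 by rewrite subr_eq0.
rewrite /G /A /b2; split.
  rewrite ET2 /ham; csimp; rewrite Eq Ep /shift_G /shift_A /shift_B.
  by field; rewrite t0 t1'.
move=> G0.
rewrite ES2 /ham; csimp; rewrite Eq Ep.
rewrite /shift_G /shift_A /shift_B in G0 *.
by field; rewrite ?t0 ?t1' ?G0.
Qed.

End Step.

(** As [T3 != 0], the recursion for T gives [G != 0], so the shift applies. The logarithmic
    derivative of [T3] is read off from [T3 * T1 = - G * T2 ^+ 2]. *)
Lemma half_state_next (n m r s T1 T2 T3 S1 S2 S3 q p : K) :
  D n = 0 -> D m = 0 -> D r = 0 -> D s = 0 ->
  T1 != 0 -> T2 != 0 -> T3 != 0 -> S1 != 0 -> S2 != 0 -> m + 1 != 0 ->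
  T3 * T1 = T2 ^+ 2 * (D (logder T2) / (t * (t - 1)) + n * (n + 1 + r)) ->
  S3 * S1 = S2 ^+ 2 * (D (logder S2) / (t * (t - 1)) + n * (n + r)) ->
  half_state n m r s T1 T2 S1 S2 q p ->
  exists q' p', pvi_state (n + 1) m r s T2 T3 S2 S3 q' p'.
Proof.
move=> Dn Dm Dr Ds T10 T20 T30 S10 S20 m0 TT TS Q.
have t1' : t - 1 != 0 by rewrite subr_eq0.
have [HT HS] := half_state_toda Dn Dm Dr Ds Q.
rewrite HT in TT.
set G := shift_G _ _ _ _ _ in HT HS TT; set A := shift_A _ _ _ in HS.
pose B := shift_B (r + m + n + 1) q p.
have G0 : G != 0.
  apply: contraNneq T30 => G0; move: TT; rewrite G0 oppr0 mulr0 => /eqP.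
  by rewrite mulf_eq0 (negPf T10) orbF.
rewrite (HS G0) in TS.
case: Q => E ET2 ET1 ES2 EST.
have Da2 : D (r + m + n + 1) = 0 by rewrite !(DD, der1) Dr Dm Dn !addr0.
have Da3 : D (- m - s) = 0 by rewrite !(DD, derN) Ds Dm oppr0 !addr0.
have Da4 : D (s - r - 1) = 0 by rewrite !(DD, derN, der1) Dr Ds oppr0 !addr0.
have [A0 B0] := shift_AB_neq0 Da2 E G0.
have [E3 H3] := ham_sys_shift Da2 Da3 Da4 E G0.
set q3 := (X in ham_sys _ _ _ _ X _) in E3 H3.
set p3 := (X in ham_sys _ _ _ _ _ X) in E3 H3.
have EP : ham (n + 1 + m) (1 - (n + 1)) (s - r - 1) (- m - s) q3 p3
     = logder T2 - n * (s + (m - 1 - r) * t).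
  rewrite ET2.
  transitivity (ham (- n - r + 2 * (r + m + n + 1) + (- m - s) + (s - r - 1))
         (- (r + m + n + 1 + (- m - s) + (s - r - 1))) (s - r - 1) (- m - s) q3 p3).
    by congr ham; ring.
  by rewrite H3; ring.
have EL : logder T3 = 2 * logder T2 - logder T1 + D G / G.
  have -> : T3 = - G * (T2 * T2 / T1) by apply: (mulIf T10); rewrite TT; field.
  by rewrite /logder; dsimp; field; rewrite T10 T20 oppr_eq0 G0.
have EX : q3 * (q3 - 1) * p3
    = ((q - 1) * A - (- m - s)) * (q * B + (s - r - 1)) * p / G.
  have -> : q3 - 1 = B * (q * B + (s - r - 1)) / G.
    by move: G0; rewrite /q3 /B /G /shift_G /shift_A /shift_B => G0; field.
  by rewrite /q3 /p3 -/A -/B -/G; field; rewrite A0 B0 G0.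
have EL3 : logder T3 = logder T2 - n * (s + (m - 1 - r) * t) - q3 * (q3 - 1) * p3
    - (r + 1) * (q3 - t) + (n + 1) * (s + (m - 1 - r) * t).
  rewrite EL EX ET1 ET2 /q3 /ham; move: G0; rewrite /G /A /B /shift_G /shift_A /shift_B => G0.
  dsimp; rewrite Dn Dm Dr Ds; case: E => -> ->.
  by field.
exists q3, p3; split.
- by apply: ham_sys_eq E3; ring.
- by rewrite EP; ring.
- by rewrite EL3 EP; ring.
- rewrite ES2 EL ET2 ET1 /q3 /ham; move: G0; rewrite /G /shift_G /shift_A /shift_B => G0.
  dsimp; rewrite Dn Dm Dr Ds; case: E => -> ->.
  by field.
- have -> : S3 = S2 ^+ 2 * (- G * (q - t) / (t * (t - 1)) * (q3 - t)) / S1.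
    by apply: (mulIf S10); rewrite TS -/q3; field; rewrite S10 t0 t1'.
  have -> : T3 = T2 ^+ 2 * (- G) / T1 by apply: (mulIf T10); rewrite TT; field.
  transitivity ((m + 1) * ((q - t) * (S2 * T1))
      * (- G * (q3 - t) * S2 * T2 / (t * (t - 1) * S1 * T1))).
    by field; rewrite S10 T10 t0 t1'.
  by rewrite EST; field; rewrite S10 T10 t0 t1'.
Qed.

(** Elimination of the momentum: the first equation is affine in [p], so it turns the second into a
    second-order equation for [q]. The parameter at infinity, [1 - a0 - 2 * a2 - a3 - a4], is
    [a1]. *)
Lemma ham_sys_pvi (a0 a2 a3 a4 q p : K) :
  D a0 = 0 -> D a2 = 0 -> D a3 = 0 -> D a4 = 0 -> (2 : K) != 0 ->
  q != 0 -> q != 1 -> q != t -> ham_sys a0 a2 a3 a4 q p ->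
  let q' := D q / (t * (t - 1)) in
  D q' / (t * (t - 1)) =
    1 / 2 * (1 / q + 1 / (q - 1) + 1 / (q - t)) * q' ^+ 2
    - (1 / t + 1 / (t - 1) + 1 / (q - t)) * q'
    + q * (q - 1) * (q - t) / (t ^+ 2 * (t - 1) ^+ 2)
      * ((1 - a0 - 2 * a2 - a3 - a4) ^+ 2 / 2 - a4 ^+ 2 / 2 * t / q ^+ 2
         + a3 ^+ 2 / 2 * (t - 1) / (q - 1) ^+ 2
         + (1 - a0 ^+ 2) / 2 * t * (t - 1) / (q - t) ^+ 2).
Proof.
move=> Da0 Da2 Da3 Da4 two0 q0; rewrite -[q == 1]subr_eq0 -[q == t]subr_eq0 => q1 qt [Eq Ep].
have t1' : t - 1 != 0 by rewrite subr_eq0.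
move=> q'; rewrite /q' Eq; dsimp; rewrite Ep Eq Da0 Da3 Da4.
by field; rewrite qt two0 q1 q0 t1' t0.
Qed.

(** At [n = 1] one has [a2 = 0], so [p = 0] is consistent, and the first equation becomes a Riccati
    equation, linearized by the first-order system for [T2] and [S2]. The formula for [q] solves the
    product relation with [T1 = S1 = 1]. *)
Lemma pvi_state_base (m r s T2 S2 : K) : D m = 0 -> D r = 0 -> D s = 0 ->
  T2 != 0 -> r + 1 != 0 ->
  D T2 = (m + 1) * S2 - (s * (t - 1) + (1 + r - m - s) * t) * T2 ->
  D S2 = (r + 1) * (t * (t - 1)) * T2 ->
  pvi_state 1 m r s 1 T2 1 S2 (t - (m + 1) / (r + 1) * (S2 / T2)) 0.
Proof.
move=> Dm Dr Ds T20 r0 ET ES; split; rewrite ?/logder ?ET ?/ham ?der1.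
- split; last by rewrite der0; ring.
  by dsimp; rewrite Dm Dr ET ES; field; rewrite T20 r0.
- by rewrite mul0r; ring.
- by field; rewrite T20 r0.
- by rewrite mul0r; field; rewrite T20 r0.
- by field; rewrite T20 r0.
Qed.

(* For r = -1 the function q_1 is infinite, but its image under sigma s1 s0 is not. *)
Lemma half_state_base (m r s T2 S2 : K) : D m = 0 -> D r = 0 -> D s = 0 ->
  T2 != 0 -> r + 1 = 0 ->
  D T2 = (m + 1) * S2 - (s * (t - 1) + (1 + r - m - s) * t) * T2 ->
  D S2 = (r + 1) * (t * (t - 1)) * T2 ->
  half_state 1 m r s 1 T2 1 S2 t ((m + 1) * S2 / (t * (t - 1) * T2)).
Proof.
move=> Dm Dr Ds T20 /eqP; rewrite addr_eq0 => /eqP -> ET ES.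
have t1' : t - 1 != 0 by rewrite subr_eq0.
split; rewrite ?/logder ?ET ?/ham ?der1.
- split; first by rewrite Dt; ring.
  by dsimp; rewrite Dm ET ES; field; rewrite T20 t0 t1'.
- by field; rewrite T20 t0 t1'.
- by rewrite mul0r; field; rewrite T20 t0 t1'.
- by rewrite ES addNr !mul0r; field; rewrite T20 t0 t1'.
- by ring.
Qed.
End Derivation.

(** * The Toda equation for determinants *)

Lemma det_schur (K : fieldType) k n (X : 'M[K]_k) (R : 'M_(k, n)) (C : 'M_(n, k))
    (A : 'M_n) : A \in unitmx ->
  \det (block_mx X R C A) = \det (X - R *m invmx A *m C) * \det A.
Proof.
move=> uA.
have -> : block_mx X R C A =
    block_mx 1%:M (R *m invmx A) 0 1%:M *m block_mx (X - R *m invmx A *m C) 0 C A.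
  by rewrite mulmx_block !mul1mx !mul0mx !add0r subrK (mulmxKV uA).
by rewrite det_mulmx det_ublock det_lblock !det1 !mul1r.
Qed.

Section DetDerivation.
Variables (K : fieldType) (D : K -> K).
Hypothesis DD : forall x y, D (x + y) = D x + D y.
Hypothesis DM : forall x y, D (x * y) = D x * y + x * D y.

Lemma der_sum (I : finType) (F : I -> K) : D (\sum_i F i) = \sum_i D (F i).
Proof. exact: (big_morph D DD (der0 DD)). Qed.

Lemma der_prod n (F : 'I_n -> K) :
  D (\prod_i F i) = \sum_i \prod_k (if k == i then D (F k) else F k).
Proof.
elim: n F => [|n IH] F; first by rewrite !big_ord0 (der1 DM).
rewrite big_ord_recl DM IH big_ord_recl; congr (_ + _).
  by rewrite big_ord_recl eqxx; congr (_ * _); apply: eq_bigr.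
rewrite mulr_sumr; apply: eq_bigr => i _.
rewrite big_ord_recl /=; congr (_ * _).
Qed.

Lemma der_det n (A : 'M[K]_n) :
  D (\det A) =
  \sum_i \det (\matrix_(k, l) (if k == i then D (A k l) else A k l)).
Proof.
rewrite der_sum exchange_big /=; apply: eq_bigr => s _.
have -> : D ((-1) ^+ s * \prod_i A i (s i)) = (-1) ^+ s * D (\prod_i A i (s i)).
  by case: (odd_perm s); rewrite /= ?expr1 ?expr0 ?mulN1r ?mul1r ?(derN DD).
rewrite der_prod mulr_sumr; apply: eq_bigr => i _; congr (_ * _).
by apply: eq_bigr => k _; rewrite mxE.
Qed.

(** Differentiate row by row. Once the multiple [c k] of the same row is split off, every
    differentiated row but the first repeats the row above it, so only the first determinant
    survives. *)
Lemma der_det_bump n (A B : 'M[K]_n.+1) (c : 'I_n.+1 -> K) :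
  (forall k l, D (A k l) = B k l - c k * A k l) ->
  (forall k l, B (lift ord0 k) l = A (widen_ord (leqnSn n) k) l) ->
  \det (\matrix_(k, l) (if k == ord0 then B k l else A k l)) =
  D (\det A) + (\sum_k c k) * \det A.
Proof.
move=> DA BA; rewrite der_det.
have E i : \det (\matrix_(k, l) (if k == i then D (A k l) else A k l)) =
  \det (\matrix_(k, l) (if k == i then B k l else A k l)) - c i * \det A.
  rewrite -[\det (\matrix_(_, _) _) in RHS]mul1r -mulNr.
  apply: (determinant_multilinear (i0 := i)).
  - by apply/rowP=> l; rewrite !mxE eqxx DA mul1r mulNr.
  - by apply/matrixP=> k l; rewrite !mxE eq_sym (negPf (neq_lift _ _)).
  - by apply/matrixP=> k l; rewrite !mxE eq_sym (negPf (neq_lift _ _)).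
rewrite (eq_bigr _ (fun i _ => E i)) sumrB -mulr_suml subrK big_ord_recl big1 ?addr0 // => i _.
apply: (determinant_alternate (i1 := lift ord0 i) (i2 := widen_ord (leqnSn n) i)).
  by apply/eqP => /(congr1 val) /=; rewrite /bump /= add1n => /eqP; rewrite gtn_eqF.
move=> l; rewrite !mxE eqxx; case: eqP => [/(congr1 val)|_] //=.
by rewrite /bump /= add1n => /eqP; rewrite ltn_eqF.
Qed.

(* f behaves like a Hankel array of iterated derivatives, up to adding constants
   c i, e j to the row and column operators. *)
Variables (f : nat -> nat -> K) (g : K) (c e : nat -> K).
Hypothesis Dl : forall i j, D (f i j) = f i.+1 j - (g + c i) * f i j.
Hypothesis Dr : forall i j, D (f i j) = f i j.+1 - (g + e j) * f i j.
Hypothesis Dc : forall i, D (c i) = 0.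

(* Rows and columns are listed by decreasing index, so that the last index,
   the one shifted by the derivation, comes first in the block decompositions. *)
Definition gdet n := \det (\matrix_(i < n, j < n) f (n - i.+1) (n - j.+1)).

(** The index list [x, n - 1, ..., 0], whose first entry can be raised from [n] to [n + 1]. *)
Let idx (x n : nat) (i : nat) : nat := if i is i'.+1 then n - i'.+1 else x.

Let hminor n x y := \det (\matrix_(i < n.+1, j < n.+1) f (idx x n i) (idx y n j)).

Let hminor_gdet n : hminor n n n = gdet n.+1.
Proof.
by congr (\det _); apply/matrixP => -[[|i] ? [[|j] ?]]; rewrite !mxE /= ?subSS ?subn0.
Qed.

Let der_hminor_row n y :
  hminor n n.+1 y = D (hminor n n y) + (\sum_(k < n.+1) (g + c (idx n n k))) * hminor n n y.
Proof.
pose B : 'M_n.+1 := \matrix_(i, j) f (idx n n i).+1 (idx y n j).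
rewrite -(@der_det_bump _ _ B).
- congr (\det _); apply/matrixP => -[[|i] ? j]; rewrite !mxE //=.
- by move=> k l; rewrite !mxE Dl.
- move=> k l; rewrite !mxE; congr (f _ _); case: k => -[|k] kn /=;
    by rewrite subnSK ?subn0.
Qed.

Let der_hminor_col n x :
  hminor n x n.+1 = D (hminor n x n) + (\sum_(k < n.+1) (g + e (idx n n k))) * hminor n x n.
Proof.
rewrite /hminor -[LHS]det_tr -[\det _ in RHS]det_tr.
pose B : 'M_n.+1 := \matrix_(j, i) f (idx x n i) (idx n n j).+1.
rewrite -(@der_det_bump _ _ B).
- congr (\det _); apply/matrixP => -[[|i] ? j]; rewrite !mxE //=.
- by move=> k l; rewrite !mxE Dr.
- move=> k l; rewrite !mxE; congr (f _ _); case: k => -[|k] kn /=;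
    by rewrite subnSK ?subn0.
Qed.

(** Jacobi's identity. All four minors border the same invertible block, so each is a Schur
    complement entry [sc x y] times [gdet n], and [gdet n.+2] is a 2 by 2 determinant of such
    entries times [gdet n]. *)
Let hminor_jacobi n : gdet n != 0 ->
  gdet n.+2 * gdet n = hminor n n n * hminor n n.+1 n.+1
                       - hminor n n.+1 n * hminor n n n.+1.
Proof.
move=> h0; pose A : 'M_n := \matrix_(i < n, j < n) f (n - i.+1) (n - j.+1).
have uA : A \in unitmx by rewrite unitmxE unitfE.
pose row x : 'rV_n := \row_j f x (n - j.+1); pose col y : 'cV_n := \col_i f (n - i.+1) y.
pose sc x y := f x y - (row x *m invmx A *m col y) 0 0.
have Em x y : hminor n x y = sc x y * gdet n.
  have -> : hminor n x y = \det (block_mx (f x y)%:M (row x) (col y) A : 'M_(1 + n)).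
    congr (\det _); apply/matrixP => i j; rewrite !mxE.
    case: splitP => i' Ei; rewrite mxE; case: splitP => j' Ej; rewrite !mxE Ei Ej ?ord1 //=.
  rewrite det_schur //; congr (_ * _).
  by rewrite det_mx11 mxE [X in _ + X]mxE [X in X - _]mxE eqxx mulr1n.
have -> : gdet n.+2 = (sc n n * sc n.+1 n.+1 - sc n.+1 n * sc n n.+1) * gdet n.
  pose ix (i : 'I_2) := if i == 0 then n.+1 else n.
  have -> : gdet n.+2 = \det (block_mx (\matrix_(i, j) f (ix i) (ix j))
      (\matrix_(i, j) row (ix i) 0 j) (\matrix_(i, j) col (ix j) i 0) A : 'M_(2 + n)).
    congr (\det _); apply/matrixP => i j; rewrite !mxE.
    have Ei (k : 'I_2) : (n.+2 - k.+1)%N = ix k by case: k => -[|[|]] //= ?; rewrite ?subSS ?subn0.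
    by case: splitP => i' ->; rewrite mxE; case: splitP => j' ->; rewrite !mxE ?Ei // !addSn !subSS.
  rewrite det_schur //; congr (_ * _).
  have -> : \matrix_(i, j) f (ix i) (ix j) - (\matrix_(i, j) row (ix i) 0 j) *m invmx A *m
      (\matrix_(i, j) col (ix j) i 0) = \matrix_(i, j) sc (ix i) (ix j).
    apply/matrixP => i j; rewrite !mxE /sc; congr (_ - _); rewrite [RHS]mxE; apply: eq_bigr => k _.
    by rewrite !mxE; congr (_ * _); apply: eq_bigr => l _; rewrite !mxE.
  rewrite (expand_det_row _ ord0) !big_ord_recl big_ord0 /cofactor !det_mx11 !mxE /=.
  by rewrite /ix /bump /= addn0 expr0 expr1; ring.
by rewrite !Em; ring.
Qed.

(** Raising the first row or column index is [D] plus multiplication by a sum. In Jacobi's identity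
    these sums cancel, except where [D] differentiates one of them and yields [n.+1%:R * D g]. *)
Lemma gdet_toda n : gdet n != 0 ->
  gdet n.+2 * gdet n = gdet n.+1 * D (D (gdet n.+1)) - D (gdet n.+1) ^+ 2
                       + n.+1%:R * D g * gdet n.+1 ^+ 2.
Proof.
move=> /hminor_jacobi ->.
rewrite der_hminor_col !der_hminor_row der_hminor_col hminor_gdet.
set h := gdet n.+1.
have DS (b : nat -> K) : (forall i, D (b i) = 0) ->
    D (\sum_(k < n.+1) (g + b (idx n n k))) = n.+1%:R * D g.
  move=> Db; rewrite der_sum (eq_bigr (fun=> D g)) ?sumr_const ?card_ord ?mulr_natl //.
  by move=> i _; rewrite DD Db addr0.
rewrite !(DD, DM) (DS _ Dc); ring.
Qed.
End DetDerivation.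

(** * The Toda recursion and the solutions of P_VI *)

Section Toda.
Variables (F K : fieldType) (c : {rmorphism F -> K}) (d : K -> K) (t : K).
Hypothesis charF0 : [pchar F] =i pred0.
Hypothesis dD : forall x y, d (x + y) = d x + d y.
Hypothesis dM : forall x y, d (x * y) = d x * y + x * d y.
Hypothesis dc : forall x, d (c x) = 0.
Hypothesis dt : d t = 1.
Hypotheses (t0 : t != 0) (t1 : t != 1).

Let t1' : t - 1 != 0. Proof. by rewrite subr_eq0. Qed.

Definition eulerD (x : K) := t * (t - 1) * d x.
Local Notation D := eulerD.

Lemma eulerDD x y : D (x + y) = D x + D y.
Proof. by rewrite /D dD mulrDr. Qed.

Lemma eulerDM x y : D (x * y) = D x * y + x * D y.
Proof. by rewrite /D dM; ring. Qed.

Lemma eulerDt : D t = t * (t - 1).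
Proof. by rewrite /D dt mulr1. Qed.

Lemma eulerD_cst x : D (c x) = 0.
Proof. by rewrite /D dc mulr0. Qed.

Definition toda (a : F) (n : nat) (x : K) : K :=
  (t ^+ 2 - t) * (x * d (d x) - d x ^+ 2) + (2 * t - 1) * x * d x
  + c ((n%:R - 1) * (n%:R + a)) * x ^+ 2.

(** With [u = t (t - 1)] and [d u = 2 t - 1], the derivative terms equal [x ^+ 2] times
    [d (u * d x / x)]. *)
Lemma toda_logder a n x : x != 0 -> toda a n x =
  x ^+ 2 * (D (logder D x) / (t * (t - 1)) + (n%:R - 1) * (n%:R + c a)).
Proof.
move=> x0; rewrite /toda rmorphM rmorphB rmorphD rmorph_nat rmorph1.
rewrite /logder eulerDM (derV eulerDD eulerDM) /D dM dM dD (derN dD) (der1 dM) dt subr0.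
by field; rewrite t0 t1' x0.
Qed.

Lemma toda0 a n : toda a n 0 = 0.
Proof. by rewrite /toda (der0 dD); ring. Qed.

Variables (m : nat) (r s : F) (T S : nat -> K).
Hypotheses (T1 : T 1 = 1) (S1 : S 1 = 1).
Hypothesis TS : forall n, T n.+3 = toda r n.+2 (T n.+2) / T n.+1.
Hypothesis SS : forall n, S n.+3 = toda (r - 1) n.+2 (S n.+2) / S n.+1.
Hypothesis dT2 : D (T 2) = (m%:R + 1) * S 2
  - (c s * (t - 1) + (1 + c r - m%:R - c s) * t) * T 2.
Hypothesis dS2 : D (S 2) = (c r + 1) * (t * (t - 1)) * T 2.

(** A zero term makes the next one zero, since [toda] vanishes at 0; hence nonvanishing passes to
    earlier indices. *)
Lemma toda_pred_neq0 a (X : nat -> K) n :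
  X 1 = 1 -> (forall n, X n.+3 = toda a n.+2 (X n.+2) / X n.+1) ->
  X n.+2 != 0 -> X n.+1 != 0.
Proof.
move=> X1 XS; case: n => [|n]; first by rewrite X1 oner_neq0.
by apply: contraNneq => X0; rewrite XS X0 toda0 mul0r.
Qed.

Lemma natK_neq0 n : (n.+1%:R : K) != 0.
Proof. by rewrite -(rmorph_nat c) fmorph_eq0 ((pcharf0P F).1 charF0). Qed.

(** Induction through [half_state]; there [q != t] because [a0] is a positive integer and the
    characteristic is 0. For [r = -1] the start is [half_state_base], since [pvi_state_base] divides
    by [r + 1]. *)
Lemma ex_pvi_state n : S n.+1 != 0 -> T n.+2 != 0 -> (c r + 1 != 0) || (0 < n)%N ->
  exists q p, pvi_state D t n.+1%:R m%:R (c r) (c s)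
    (T n.+1) (T n.+2) (S n.+1) (S n.+2) q p.
Proof.
have Dr := eulerD_cst r; have Ds := eulerD_cst s.
have Dn k : D k%:R = 0 := der_nat eulerDD eulerDM k.
have m0 : m%:R + 1 != 0 :> K by rewrite natr1 natK_neq0.
have QP k q p : S k.+2 != 0 -> T k.+3 != 0 ->
    half_state D t k.+1%:R m%:R (c r) (c s) (T k.+1) (T k.+2) (S k.+1) (S k.+2) q p ->
    exists q' p', pvi_state D t k.+2%:R m%:R (c r) (c s)
      (T k.+2) (T k.+3) (S k.+2) (S k.+3) q' p'.
  move=> S2 T3; have T2 := toda_pred_neq0 T1 TS T3.
  have T10 := toda_pred_neq0 T1 TS T2; have S10 := toda_pred_neq0 S1 SS S2.
  rewrite -[k.+2%:R]natr1; apply: (half_state_next eulerDD eulerDM eulerDt t0 t1) => //.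
    by rewrite TS divfK // toda_logder // -natr1 addrK.
  by rewrite SS divfK // toda_logder // rmorphB rmorph1 -natr1 addrK addrCA addrK addrC.
elim: n => [|n IH] Sn Tn.
  rewrite orbF => r0; eexists; eexists; rewrite T1 S1.
  exact: (pvi_state_base eulerDD eulerDM eulerDt (Dn m) Dr Ds Tn r0 dT2 dS2).
have T2 := toda_pred_neq0 T1 TS Tn; have S2 := toda_pred_neq0 S1 SS Sn.
have [r0 _|r0 _] := boolP (c r + 1 != 0).
  have [|q [p P]] := IH S2 T2; first by rewrite r0.
  have qt : q != t.
    case: P => P _ _ _ _; apply: (ham_sys_neqt eulerDt t0 t1 P).
    by rewrite -natrD addSn natK_neq0.
  apply: (QP _ _ _ Sn Tn).
  apply: (pvi_state_half eulerDD eulerDM eulerDt t0 t1 (Dn _) (Dn _) Dr Ds _ _ _ m0 r0 qt P) => //.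
  exact: toda_pred_neq0 T1 TS T2.
move/negbNE/eqP: r0 => r0.
case: n {IH} Sn Tn T2 S2 => [|n] Sn Tn T2 S2.
  apply: (QP _ _ _ Sn Tn); rewrite T1 S1.
  exact: (half_state_base eulerDD eulerDM eulerDt t0 t1 (Dn m) Dr Ds T2 r0 dT2 dS2).
(* When r = -1, only n = 2 was to be treated. *)
have S30 : S 3 = 0.
  (* By [dS2] the term [S 2] is constant, and the coefficient [(2 - 1) * (2 + (r - 1))] in the
     recursion equals [r + 1 = 0]. *)
  have dS0 : d (S 2) = 0.
    move/eqP: dS2; rewrite r0 !mul0r /D !mulf_eq0 (negPf t0) (negPf t1') => /eqP //.
  have cr : c (2 - 1) * c (2 + (r - 1)) = 0.
    by rewrite !(rmorphB, rmorphD) rmorph1 -[RHS](mulr0 (1 + 1 - 1)) -r0; ring.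
  by rewrite SS /toda dS0 rmorphM cr (der0 dD); ring.
have Sz k : S k.+3 = 0 by elim: k => // k IHk; rewrite SS IHk toda0 mul0r.
by rewrite Sz eqxx in Sn.
Qed.

(** As [n + r] is invertible, the clause of [pvi_state] for [S1] can be solved for [q] and yields
    [q_n]. The parameters [a4], [a3], [a0] are nonzero, which keeps [q] away from 0, 1 and [t]. *)
Lemma toda_pvi n : (0 < n)%N -> n%:R + r != 0 -> S n != 0 -> T n.+1 != 0 ->
  m%:R + s != 0 -> r - s + 1 != 0 ->
  let q := t + t * (t - 1) / c (n%:R + r) *
    (d (S n) / S n - d (T n.+1) / T n.+1
     - c (n%:R + s - 1) / t - c (n%:R + r - m%:R - s) / (t - 1)) in
  [/\ q != 0, q != 1, q != t &
    d (d q) = 1 / 2 * (1 / q + 1 / (q - 1) + 1 / (q - t)) * d q ^+ 2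
      - (1 / t + 1 / (t - 1) + 1 / (q - t)) * d q
      + q * (q - 1) * (q - t) / (t ^+ 2 * (t - 1) ^+ 2)
        * (c ((n%:R + r) ^+ 2 / 2) + c (- ((m%:R + s) ^+ 2 / 2)) * t / q ^+ 2
           + c ((r - s + 1) ^+ 2 / 2) * (t - 1) / (q - 1) ^+ 2
           + c ((1 - (n%:R + m%:R) ^+ 2) / 2) * t * (t - 1) / (q - t) ^+ 2)].
Proof.
case: n => // n _ nr Sn Tn ms rs q.
have cnr : n.+1%:R + c r != 0 by rewrite -(rmorph_nat c) -rmorphD fmorph_eq0.
have [|q0 [p P]] := ex_pvi_state Sn Tn.
  rewrite orbC -implyNb -eqn0Ngt; apply/implyP => /eqP n0.
  by move: cnr; rewrite n0 addrC.
have Eq : q = q0.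
  case: P => _ _ _ ES _.
  have -> : q0 = t + (logder D (S n.+1) - logder D (T n.+2) - (n.+1%:R + c s - 1) * (t - 1)
      - (n.+1%:R + c r - m%:R - c s) * t) / (n.+1%:R + c r).
    by rewrite ES; move: (n.+1%:R) cnr => k kr; field.
  rewrite /q !(rmorphB, rmorphD, rmorph_nat, rmorph1) /logder /D.
  move: (n.+1%:R) cnr => k kr.
  by field; rewrite kr Tn Sn t1' t0.
rewrite Eq; case: P => P _ _ _ _.
have D0 x : D (c x) = 0 := eulerD_cst x.
have Da k : D (k%:R) = 0 by exact: (der_nat eulerDD eulerDM).
have two0 : (2 : K) != 0 by exact: (natK_neq0 1).
have q00 : q0 != 0.
  apply: (ham_sys_neq0 eulerDD t0 P).
  by rewrite -(rmorph_nat c) -rmorphN -rmorphB fmorph_eq0 -opprD oppr_eq0.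
have q01 : q0 != 1.
  apply: (ham_sys_neq1 eulerDM t1 P).
  rewrite -(rmorph1 c) -!rmorphB fmorph_eq0.
  by apply: contraNneq rs => E; rewrite -oppr_eq0 -E; apply/eqP; ring.
have q0t : q0 != t.
  by apply: (ham_sys_neqt eulerDt t0 t1 P); rewrite -natrD addSn natK_neq0.
split=> //.
have Dd x : D x / (t * (t - 1)) = d x by rewrite /D; field; rewrite t0 t1'.
have := ham_sys_pvi eulerDD eulerDM eulerDt t0 t1 _ _ _ _ two0 q00 q01 q0t P.
cbv zeta; rewrite !Dd => -> //.
- rewrite !(rmorphM, rmorphN, rmorphB, rmorphD, rmorphXn, fmorphV, rmorph_nat, rmorph1).
  by congr (_ + _ * _); field; rewrite ?two0 ?q00 ?subr_eq0 ?q01 ?q0t.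
- by rewrite eulerDD !Da addr0.
- by rewrite eulerDD (derN eulerDD) (der1 eulerDM) Da subr0.
- by rewrite !eulerDD !(derN eulerDD) !D0 (der1 eulerDM) !subr0.
- by rewrite eulerDD !(derN eulerDD) D0 Da; ring.
Qed.

End Toda.

(** * Determinant solutions of the Toda recursion *)

Section TodaDet.
Variables (F K : fieldType) (c : {rmorphism F -> K}) (d : K -> K) (t : K).
Hypothesis dD : forall x y, d (x + y) = d x + d y.
Hypothesis dM : forall x y, d (x * y) = d x * y + x * d y.
Hypothesis dc : forall x, d (c x) = 0.
Hypothesis dt : d t = 1.
Hypotheses (t0 : t != 0) (t1 : t != 1).

(* With g = (a + 2) t, the functions t^i (t-1)^j e i j arise from e 0 0 by the
   commuting operators D + g + i and D + g - (j + a + 2), which raise the order of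
   vanishing at t = 0 and at t = 1 respectively. *)
Variables (a : F) (e : nat -> nat -> K).
Hypothesis er : forall i j,
  e i.+1 j = c ((i + j)%:R + a + 2) * e i j + (t - 1) * d (e i j).
Hypothesis ec : forall i j,
  e i j.+1 = c ((i + j)%:R + a + 2) * e i j + t * d (e i j).

Definition edet n := \det (\matrix_(i < n, j < n) e (n - i.+1) (n - j.+1)).

Local Notation D := (eulerD d t).
Local Notation u := (t * (t - 1)).
Let u0 : u != 0. Proof. by rewrite mulf_neq0 // subr_eq0. Qed.
Let DD : forall x y, D (x + y) = D x + D y. Proof. exact: eulerDD. Qed.
Let DM : forall x y, D (x * y) = D x * y + x * D y. Proof. exact: eulerDM. Qed.
Let Dt : D t = t * (t - 1). Proof. exact: eulerDt. Qed.

Lemma eulerDX n : D (t ^+ n) = n%:R * (t - 1) * t ^+ n.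
Proof.
elim: n => [|n IH]; first by rewrite expr0 (der1 DM) mul0r mul0r.
by rewrite exprS DM Dt IH -natr1; ring.
Qed.

Lemma eulerDX1 n : D ((t - 1) ^+ n) = n%:R * t * (t - 1) ^+ n.
Proof.
elim: n => [|n IH]; first by rewrite expr0 (der1 DM) mul0r mul0r.
by rewrite exprS DM IH -natr1 DD (derN DD) (der1 DM) Dt; ring.
Qed.

Let f i j := t ^+ i * (t - 1) ^+ j * e i j.
Let g := (c a + 2) * t.

Let Dl i j : D (f i j) = f i.+1 j - (g + i%:R) * f i j.
Proof.
rewrite /f er !DM eulerDX eulerDX1 natrD !(rmorphD, rmorph_nat) /g /eulerD exprS.
ring.
Qed.

Let Dr i j : D (f i j) = f i j.+1 - (g + (- (j%:R + c a + 2))) * f i j.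
Proof.
rewrite /f ec !DM eulerDX eulerDX1 natrD !(rmorphD, rmorph_nat) /g /eulerD exprS.
ring.
Qed.

Lemma prod_exp_rev (x : K) n : \prod_(i < n) x ^+ (n - i.+1) = x ^+ 'C(n, 2).
Proof.
elim: n => [|n IH]; first by rewrite big_ord0.
rewrite big_ord_recl /= subSS subn0 binS bin1 addnC exprD -IH; congr (_ * _).
Qed.

(** A power of [t] comes out of each row and one of [t - 1] out of each column, with exponents
    [n - 1, ..., 0] in both cases. *)
Lemma gdet_edet n : gdet f n = u ^+ 'C(n, 2) * edet n.
Proof.
rewrite exprMn /gdet; set M := (X in \det X).
have -> : M = diag_mx (\row_(i < n) t ^+ (n - i.+1))
    *m (\matrix_(i, j) e (n - i.+1) (n - j.+1))
    *m diag_mx (\row_(j < n) (t - 1) ^+ (n - j.+1)).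
  apply/matrixP => i j; rewrite mul_mx_diag mul_diag_mx !mxE /f; ring.
rewrite !det_mulmx !det_diag -!prod_exp_rev mulrAC; congr (_ * _ * _).
  by apply: eq_bigr => i _; rewrite mxE.
by apply: eq_bigr => i _; rewrite mxE.
Qed.

(** Since [D (D u / u) = 2 u], the power [u ^+ 'C(n.+1, 2)] contributes [(n + 1) n]; with
    [(n + 1) (a + 2)] from [D g] this is the coefficient [(n + 1) (n + 2 + a)] of [toda]. The left
    side carries one more factor [u] than the squared power, matched on the right by [D = u d]. *)
Lemma edet_toda n : edet n != 0 -> edet n.+2 * edet n = toda c d t a n.+2 (edet n.+1).
Proof.
move=> E0.
have h0 : gdet f n != 0 by rewrite gdet_edet mulf_neq0 ?expf_neq0.
have Dn k : D k%:R = 0 := der_nat DD DM k.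
have := gdet_toda DD DM Dl Dr Dn h0.
rewrite !gdet_edet.
have E2 : 'C(n.+1, 2)%:R * 2 = n.+1%:R * n%:R :> K.
  elim: {h0 E0} n => [|k IH]; first by rewrite !mulr0 mul0r.
  by rewrite binS natrD mulrDl IH bin1 -!natr1; ring.
have Du : D u = (2 * t - 1) * u.
  by rewrite DM DD (derN DD) (der1 DM) Dt; ring.
have DV k : D (u ^+ k) = k%:R * (2 * t - 1) * u ^+ k.
  elim: k => [|k IH]; first by rewrite expr0 (der1 DM) !mul0r.
  by rewrite exprS DM IH Du -natr1; ring.
set h := edet n.+1.
have -> : u ^+ 'C(n.+2, 2) * edet n.+2 * (u ^+ 'C(n, 2) * edet n) =
   (u ^+ 'C(n.+1, 2)) ^+ 2 * u * (edet n.+2 * edet n).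
  rewrite -exprM -exprSr. have -> : ('C(n.+1, 2) * 2).+1 = ('C(n.+2, 2) + 'C(n, 2))%N.
    by rewrite !binS !bin1 !bin0 -addn1; ring.
  by rewrite exprD; ring.
set V := u ^+ _; have V0 : V != 0 by rewrite expf_neq0.
have DVV := DV 'C(n.+1, 2).
rewrite -/V in DVV; move: ('C(n.+1, 2)%:R) E2 DVV (Dn 'C(n.+1, 2)) => k E2 DVV Dk.
have DVh : D (V * h) = V * (k * (2 * t - 1) * h + D h) by rewrite DM DVV; ring.
have D2t : D (2 * t - 1) = 2 * u by rewrite !DD !DM (Dn 2) (derN DD) (der1 DM) Dt; ring.
have DDVh : D (D (V * h)) =
    V * ((k * (2 * t - 1)) ^+ 2 * h + 2 * k * u * h + 2 * k * (2 * t - 1) * D h + D (D h)).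
  by rewrite DVh DM DVV DD (DM _ h) (DM k) Dk D2t; ring.
have Dg : D g = (c a + 2) * u.
  by rewrite DM DD (Dn 2) Dt {1}/eulerD dc mulr0 add0r mul0r add0r.
rewrite DDVh DVh Dg => E; apply: (mulfI (mulf_neq0 (expf_neq0 2 V0) u0)).
rewrite E /toda rmorphM rmorphB (rmorphD c) rmorph_nat rmorph1.
have -> : D h = u * d h by [].
have -> : D (u * d h) = u * ((2 * t - 1) * d h + u * d (d h)).
  by rewrite DM Du /eulerD; ring.
have -> : n.+2%:R = n.+1%:R + 1 :> K by rewrite natr1.
transitivity (V ^+ 2 * u * (u * (h * d (d h) - d h ^+ 2) + (2 * t - 1) * h * d h
   + (k * 2 + n.+1%:R * (c a + 2)) * h ^+ 2)); first by ring.
by rewrite E2 -natr1; ring.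
Qed.
End TodaDet.

(** * Rational functions and the polynomials W *)

Lemma quotient_ruleD (R : comNzRingType) (K : fieldType) (f : {rmorphism R -> K})
    (p q a b p' q' a' b' : R) :
  f q != 0 -> f b != 0 ->
  f ((p' * b + p * b' + (a' * q + a * q')) * (q * b)
   - (p * b + a * q) * (q' * b + q * b')) / f ((q * b) ^+ 2)
  = f (p' * q - p * q') / f (q ^+ 2) + f (a' * b - a * b') / f (b ^+ 2).
Proof.
by move=> q0 b0; rewrite !(rmorphM, rmorphB, rmorphD, rmorphXn) /=; field; rewrite q0 b0.
Qed.

Lemma quotient_ruleM (R : comNzRingType) (K : fieldType) (f : {rmorphism R -> K})
    (p q a b p' q' a' b' : R) :
  f q != 0 -> f b != 0 ->
  f ((p' * a + p * a') * (q * b) - p * a * (q' * b + q * b')) / f ((q * b) ^+ 2)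
  = f (p' * q - p * q') / f (q ^+ 2) * (f a / f b)
    + f p / f q * (f (a' * b - a * b') / f (b ^+ 2)).
Proof.
by move=> q0 b0; rewrite !(rmorphM, rmorphB, rmorphD, rmorphXn) /=; field; rewrite q0 b0.
Qed.

Section RatfunDerivation.
Variable F : fieldType.
Local Notation ratfun := {fraction {poly F}}.
Local Notation t := (tvar F).

Lemma ratfun_divP (x : ratfun) :
  exists p q : {poly F}, q != 0 /\ x = p%:F / q%:F.
Proof.
exists (\n_(repr x)), (\d_(repr x)); have d0 : \d_(repr x) != 0 by exact: denom_ratioP.
split=> //; apply: (@mulIf _ (\d_(repr x))%:F); first by rewrite tofrac_eq0.
rewrite divfK ?tofrac_eq0 // -{1}[x]reprK.
unlock FracField.tofrac; rewrite -[LHS]FracField.pi_mul.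
apply/eqmodP; rewrite /= FracField.equivfE /FracField.mulf.
rewrite !numden_Ratio ?mulf_neq0 ?oner_neq0 //.
by apply/eqP; ring.
Qed.

Lemma derivF_poly (p : {poly F}) : derivF p%:F = (p^`())%:F.
Proof.
have := @derivF_div F p 1 (oner_neq0 _).
by rewrite tofrac1 divr1 expr1n divr1 mulr1 derivC mulr0 subr0.
Qed.

Lemma derivFD (x y : ratfun) : derivF (x + y) = derivF x + derivF y.
Proof.
have [p [q [q0 ->]]] := ratfun_divP x; have [a [b [b0 ->]]] := ratfun_divP y.
have qF : q%:F != 0 :> ratfun by rewrite tofrac_eq0.
have bF : b%:F != 0 :> ratfun by rewrite tofrac_eq0.
have -> : p%:F / q%:F + a%:F / b%:F = (p * b + a * q)%:F / (q * b)%:F :> ratfun.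
  rewrite (addf_div _ _ qF bF) tofracD; rewrite (tofracM p) (tofracM a) (tofracM q).
  reflexivity.
rewrite (derivF_div _ (mulf_neq0 q0 b0)) (derivF_div _ q0) (derivF_div _ b0).
rewrite ?(derivD, derivM).
exact: (@quotient_ruleD _ _ (@FracField.tofrac {poly F}) p q a b p^`() q^`() a^`() b^`() qF bF).
Qed.

Lemma derivFM (x y : ratfun) : derivF (x * y) = derivF x * y + x * derivF y.
Proof.
have [p [q [q0 ->]]] := ratfun_divP x; have [a [b [b0 ->]]] := ratfun_divP y.
have qF : q%:F != 0 :> ratfun by rewrite tofrac_eq0.
have bF : b%:F != 0 :> ratfun by rewrite tofrac_eq0.
have -> : p%:F / q%:F * (a%:F / b%:F) = (p * a)%:F / (q * b)%:F :> ratfun.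
  rewrite mulf_div (tofracM p) (tofracM q).
  reflexivity.
rewrite (derivF_div _ (mulf_neq0 q0 b0)) (derivF_div _ q0) (derivF_div _ b0).
rewrite ?(derivD, derivM).
exact: (@quotient_ruleM _ _ (@FracField.tofrac {poly F}) p q a b p^`() q^`() a^`() b^`() qF bF).
Qed.

Lemma derivF_cst c : derivF (cst c) = 0 :> ratfun.
Proof. by rewrite derivF_poly derivC tofrac0. Qed.

Lemma derivF_tvar : derivF t = 1.
Proof. by rewrite derivF_poly derivX tofrac1. Qed.

Lemma tvar_neq0 : t != 0.
Proof. by rewrite tofrac_eq0 polyX_eq0. Qed.

Lemma tvar_neq1 : t != 1.
Proof.
by rewrite -subr_eq0 -tofrac1 -tofracB tofrac_eq0 polyXsubC_eq0.
Qed.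

End RatfunDerivation.

(** * Formal top coefficients of polynomials *)

Section Top.
Variable R : idomainType.
Implicit Types p q : {poly R}.

Lemma coefM_top p q k l : (size p <= k.+1)%N -> (size q <= l.+1)%N ->
  (p * q)`_(k + l) = p`_k * q`_l.
Proof.
move=> sp sq; rewrite coefM (bigD1 (Ordinal (leq_addr l k.+1))) //= addKn big1 ?addr0 // => i ik.
have [lik|lki] := ltnP i k.
  by rewrite [q`__]nth_default ?mulr0 // (leq_trans sq) // ltn_subRL ltn_add2r.
by rewrite nth_default ?mul0r // (leq_trans sp) // ltn_neqAle lki eq_sym andbT.
Qed.

(** The value [a] may be 0: only a formal degree is prescribed, which makes the notion stable under
    sums and products. *)
Definition topcoef k (a : R) p := (size p <= k.+1)%N /\ p`_k = a.

Lemma topcoefM k l a b p q :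
  topcoef k a p -> topcoef l b q -> topcoef (k + l) (a * b) (p * q).
Proof.
move=> [sp <-] [sq <-]; split; last exact: coefM_top.
apply: leq_trans (size_polyMleq _ _) _.
by rewrite -subn1 leq_subLR add1n -addSn -addnS leq_add.
Qed.

Lemma topcoefD k a b p q : topcoef k a p -> topcoef k b q -> topcoef k (a + b) (p + q).
Proof.
move=> [sp <-] [sq <-]; split; last by rewrite coefD.
by rewrite (leq_trans (size_polyD _ _)) // geq_max sp.
Qed.

Lemma topcoefB k a b p q : topcoef k a p -> topcoef k b q -> topcoef k (a - b) (p - q).
Proof.
move=> tp [sq <-]; apply: topcoefD => //.
by split; rewrite ?size_polyN // coefN.
Qed.

Lemma topcoefZ k c a p : topcoef k a p -> topcoef k (c * a) (c%:P * p).
Proof.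
move=> [sp <-]; rewrite mul_polyC; split; last by rewrite coefZ.
exact: leq_trans (size_scale_leq _ _) sp.
Qed.

Lemma topcoef_theta k a p : topcoef k a p -> topcoef k (k%:R * a) ('X * p^`()).
Proof.
move=> [sp <-]; split; last first.
  by rewrite coefXM; case: k {sp} => [|k]; rewrite ?mul0r // coef_deriv mulr_natl.
apply/leq_sizeP => j kj; rewrite coefXM; case: j kj => // j kj.
by rewrite coef_deriv nth_default ?mul0rn // (leq_trans sp).
Qed.

Definition toda_poly (N : R) p : {poly R} :=
  ('X ^+ 2 - 'X) * (p * p^`()^`() - p^`() ^+ 2) + (2 * 'X - 1) * p * p^`() + N%:P * p ^+ 2.

(** In terms of [th = X d/dX] the polynomial is [A - L]. The terms of [A] add up to
    [(k ^ 2 - k) - k ^ 2 + 2 k + N = k + N] times [a * a]; [L] has lower degree because ['X * L]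
    already has formal degree [k + k]. *)
Lemma topcoef_toda_poly N p k a : topcoef k a p ->
  topcoef (k + k) ((k%:R + N) * (a * a)) (toda_poly N p).
Proof.
move=> tp; have tt := topcoef_theta tp; have ttt := topcoef_theta tt.
set th := fun q : {poly R} => 'X * q^`().
pose L := 'X * (p * p^`()^`() - p^`() ^+ 2) + p * p^`().
have EL : 'X * L = p * th (th p) - th p * th p by rewrite /L /th derivM derivX; ring.
pose A := p * (th (th p) - th p) - th p * th p + 2%:P * (p * th p) + N%:P * (p * p).
have EA : toda_poly N p = A - L by rewrite /toda_poly /A /L /th derivM derivX; ring.
have [sXL _] := topcoefB (topcoefM tp ttt) (topcoefM tt tt).
rewrite -/(th p) -/(th (th p)) -EL in sXL.
have sL : (size L <= k + k)%N.
  have [->|L0] := eqVneq L 0; first by rewrite size_poly0.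
  by move: sXL; rewrite -commr_polyX size_mulX.
have [sA cA] := topcoefD (topcoefD (topcoefB (topcoefM tp (topcoefB ttt tt))
  (topcoefM tt tt)) (topcoefZ 2 (topcoefM tp tt))) (topcoefZ N (topcoefM tp tp)).
rewrite EA; split.
  rewrite (leq_trans (size_polyD _ _)) // geq_max sA size_polyN.
  exact: leq_trans sL (leqnSn _).
rewrite coefB [L`__]nth_default // subr0 cA; ring.
Qed.

Lemma topcoef_factor k l b c p q : b != 0 -> c != 0 ->
  topcoef l b q -> topcoef (k + l) c (p * q) -> exists2 b', b' != 0 & topcoef k b' p.
Proof.
move=> b0 c0 tq [spq cpq].
have sq : size q = l.+1.
  case: tq => sq qb; apply/eqP; rewrite eqn_leq sq ltnNge.
  by apply: contra b0 => sl; rewrite -qb nth_default.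
have pq0 : p * q != 0 by apply: contraNneq c0 => pq0; rewrite -cpq pq0 coef0.
move: (pq0); rewrite mulf_eq0 negb_or => /andP [p0 q0].
have sp : (size p <= k.+1)%N.
  by move: spq; rewrite size_mul // sq addnS /= -addSn leq_add2r.
exists p`_k => //; apply: contraNneq c0 => pk.
by have [_] := topcoefM (conj sp pk) tq; rewrite cpq mul0r => ->.
Qed.

Lemma rmorph_toda_poly (K : nzRingType) (f : {rmorphism {poly R} -> K}) N p :
  f (toda_poly N p) = (f 'X ^+ 2 - f 'X) * (f p * f p^`()^`() - f p^`() ^+ 2)
    + (2 * f 'X - 1) * f p * f p^`() + f N%:P * f p ^+ 2.
Proof.
by rewrite /toda_poly !(rmorphD, rmorphM, rmorphB, rmorphXn, rmorphN) rmorph1.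
Qed.
End Top.

(** * Polynomiality and nonvanishing of Toda sequences *)

Section TodaSequence.
Variable F : fieldType.
Local Notation ratfun := {fraction {poly F}}.
Local Notation t := (tvar F).

Definition cst_morph : {rmorphism F -> ratfun} := @FracField.tofrac {poly F} \o @polyC F.

Variables (a : F) (w : {poly F}).

Fixpoint epoly_col j : {poly F} :=
  if j is j'.+1 then (j'%:R + a + 2)%:P * epoly_col j' + 'X * (epoly_col j')^`() else w.

Fixpoint epoly i j : {poly F} :=
  if i is i'.+1
  then ((i' + j)%:R + a + 2)%:P * epoly i' j + ('X - 1) * (epoly i' j)^`()
  else epoly_col j.

(** The operators raising [i] and [j] commute, so the column rule, built into [epoly_col] at
    [i = 0], persists for all [i]. *)
Lemma epolySr i j :
  epoly i j.+1 = ((i + j)%:R + a + 2)%:P * epoly i j + 'X * (epoly i j)^`().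
Proof.
elim: i => [|i IH] //=; rewrite IH -/(epoly i j) addnS addSn -natr1.
rewrite !derivE /=; rewrite !(polyCD, polyC1).
by ring.
Qed.

Lemma toda_seqE (x : ratfun) n :
  toda_seq a x n.+3 = toda cst_morph (@derivF F) t a n.+2 (toda_seq a x n.+2) / toda_seq a x n.+1.
Proof. by []. Qed.

Let ef i j : ratfun := (epoly i j)%:F.

Let efSl i j : ef i.+1 j = cst_morph ((i + j)%:R + a + 2) * ef i j + (t - 1) * derivF (ef i j).
Proof.
have -> : t - 1 = ('X - 1)%:F by rewrite tofracB tofrac1.
by rewrite derivF_poly /ef /= tofracD tofracM tofracM.
Qed.

Let efSr i j : ef i j.+1 = cst_morph ((i + j)%:R + a + 2) * ef i j + t * derivF (ef i j).
Proof.
by rewrite derivF_poly /ef epolySr tofracD tofracM tofracM.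
Qed.

Lemma derivF_cst_morph c : derivF (cst_morph c) = 0.
Proof. exact: derivF_cst. Qed.

Definition epoly_det n := \det (\matrix_(i < n, j < n) epoly (n - i.+1) (n - j.+1)).

Lemma edet_epoly n : edet ef n = (epoly_det n)%:F.
Proof.
rewrite /edet /epoly_det -det_map_mx; congr (\det _).
by apply/matrixP => i j; rewrite !mxE.
Qed.

(** While no determinant vanishes, [edet_toda] justifies the division in the recursion; once a term
    is 0, all later ones are. *)
Lemma toda_seq_det n :
  toda_seq a w%:F n.+1 = edet ef n \/ toda_seq a w%:F n.+1 = 0.
Proof.
set X := toda_seq a w%:F.
have X0 k : X k.+2 = 0 -> X k.+3 = 0.
  by move=> Xk; rewrite /X toda_seqE -/X Xk (toda0 _ _ (@derivFD F)) mul0r.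
suff : (X n.+1 = edet ef n /\ X n.+2 = edet ef n.+1 /\ edet ef n != 0)
    \/ X n.+2 = 0 /\ (X n.+1 = edet ef n \/ X n.+1 = 0).
  by case=> [[-> _]|[]]; [left|].
elim: n => [|n IH].
  left; rewrite /edet det_mx00 oner_neq0; do 2!split=> //.
  by rewrite det_mx11 mxE.
case: IH => [[X1 [X2 e0]]|[X2 X1]]; last by right; split; [exact: X0|right].
have [e1|e1] := eqVneq (edet ef n.+1) 0.
  by right; split; [apply: X0; rewrite X2|left].
left; split=> //; split=> //.
rewrite /X toda_seqE -/X X1 X2.
rewrite -(edet_toda (@derivFD F) (@derivFM F) derivF_cst_morph (derivF_tvar F)
  (tvar_neq0 F) (tvar_neq1 F) efSl efSr e0).
by rewrite (mulfK e0).
Qed.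

Lemma toda_seq_polynomial n : is_polynomial (toda_seq a w%:F n.+1).
Proof.
case: (toda_seq_det n) => ->; last by exists 0; rewrite tofrac0.
by exists (epoly_det n); rewrite edet_epoly.
Qed.

Lemma toda_toda_poly n (p : {poly F}) :
  toda cst_morph (@derivF F) t a n p%:F = (toda_poly ((n%:R - 1) * (n%:R + a)) p)%:F.
Proof.
rewrite (rmorph_toda_poly (@FracField.tofrac {poly F})) /toda !derivF_poly.
reflexivity.
Qed.

(** Formal degrees [n * k] are consistent since [2 (n + 1) k = (n + 2) k + n k], and the factor
    supplied by [topcoef_toda_poly] is nonzero by [N0]. *)
Lemma toda_seq_neq0 k : topcoef k w`_k w -> w`_k != 0 ->
  (forall n, (0 < n)%N -> (n * k)%:R + (n%:R * (n.+1%:R + a)) != 0) ->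
  forall n, toda_seq a w%:F n.+1 != 0.
Proof.
move=> tw w0 N0; set X := toda_seq a w%:F.
suff H n : exists2 p, X n.+1 = p%:F & exists2 b, b != 0 & topcoef (n * k) b p.
  move=> n; have [p -> [b b0 [_ Eb]]] := H n; rewrite tofrac_eq0.
  by apply: contraNneq b0 => p0; rewrite -Eb p0 coef0.
suff: (exists2 p, X n.+1 = p%:F & exists2 b, b != 0 & topcoef (n * k) b p) /\
    (exists2 p, X n.+2 = p%:F & exists2 b, b != 0 & topcoef (n.+1 * k) b p) by case.
elim: n => [|n [[p Ep [b b0 tp]] [q Eq [b' b0' tq]]]].
  split; last by exists w => //; exists w`_k; rewrite ?mul1n.
  exists 1; first by rewrite tofrac1.
  by exists 1; rewrite ?oner_neq0 //; split; rewrite ?mul0n ?size_poly1 ?coef1.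
split; first by exists q => //; exists b'.
have [l El] := toda_seq_polynomial n.+2; exists l => //.
have p0 : p != 0.
  by apply: contraNneq b0 => p0; case: tp => _ <-; rewrite p0 coef0.
have E : l * p = toda_poly ((n.+2%:R - 1) * (n.+2%:R + a)) q.
  apply/eqP; rewrite -tofrac_eq tofracM -El -toda_toda_poly toda_seqE -/X Ep Eq.
  by apply/eqP; apply: divfK; rewrite tofrac_eq0.
have tl := topcoef_toda_poly ((n.+2%:R - 1) * (n.+2%:R + a)) tq.
rewrite -E in tl.
have Ek : (n.+1 * k + n.+1 * k = n.+2 * k + n * k)%N by rewrite !mulSn; ring.
rewrite Ek in tl; apply: topcoef_factor b0 _ tp tl.
rewrite !mulf_neq0 //.
by have := N0 n.+1 isT; rewrite -[n.+2%:R]natr1 addrK.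
Qed.

End TodaSequence.

(** * Contiguity relations for the polynomials W *)

Section Binomial.
Variables (F : fieldType) (charF0 : [pchar F] =i pred0).

Lemma natr_neq0 n : (n.+1%:R : F) != 0.
Proof. by rewrite ((pcharf0P F).1 charF0). Qed.

Lemma gbinom0 (x : F) : gbinom x 0 = 1.
Proof. by rewrite /gbinom big_ord0 divr1. Qed.

Lemma gbinomS (x : F) k : gbinom x k.+1 * k.+1%:R = gbinom x k * (x - k%:R).
Proof.
rewrite /gbinom big_ord_recr factS natrM /= invfM -!mulrA; congr (_ * _).
have kf : k`!%:R != 0 :> F by rewrite -(prednK (fact_gt0 k)) natr_neq0.
by field; rewrite kf addrC natr1 natr_neq0.
Qed.

Lemma gbinomSS (x : F) k : gbinom (x + 1) k.+1 * k.+1%:R = (x + 1) * gbinom x k.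
Proof.
rewrite /gbinom big_ord_recl factS natrM /= invfM subr0.
rewrite (eq_bigr (fun i : 'I_k => x - i%:R)); last first.
  by move=> i _; rewrite /bump /= add1n -natr1; ring.
have kf : k`!%:R != 0 :> F by rewrite -(prednK (fact_gt0 k)) natr_neq0.
by field; rewrite kf addrC natr1 natr_neq0.
Qed.

Variables (r s : F) (m : nat).
Let c j : F := (-1) ^+ j * gbinom (s + m%:R) j.
Let w j : F := c j * gbinom (r + m%:R + 1 - j%:R) (m - j).

Let W_sum : W r m s = \sum_(j < m.+1) w j *: 'X^(m - j).
Proof. by apply: eq_bigr => j _; rewrite /w /c; congr (_ *: _); ring. Qed.

Let W'_sum : W (r - 1) m.+1 (s - 1) =
  \sum_(j < m.+2) (c j * gbinom (r + m%:R + 1 - j%:R) (m.+1 - j)) *: 'X^(m.+1 - j).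
Proof.
apply: eq_bigr => j _; rewrite /c; congr (_ *: _).
have -> : r - 1 + m.+1%:R + 1 - j%:R = r + m%:R + 1 - j%:R by rewrite -natr1; ring.
have -> : s - 1 + m.+1%:R = s + m%:R by rewrite -natr1; ring.
ring.
Qed.

Let natB j : (j <= m)%N -> (m - j)%:R = m%:R - j%:R :> F.
Proof. by move=> ?; rewrite natrB. Qed.

(** The parameter shifts cancel in [s + m] and [r + m + 1 - j]. Differentiation brings down
    [m + 1 - j], which lowers the second binomial at the cost of the factor [r + 1]. *)
Lemma deriv_W' : (W (r - 1) m.+1 (s - 1))^`() = (r + 1)%:P * W r m s.
Proof.
rewrite W'_sum W_sum big_ord_recr /= subnn expr0 alg_polyC.
rewrite derivD derivC addr0 raddf_sum /= mul_polyC scaler_sumr; apply: eq_bigr => j _.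
have jm : (j <= m)%N by rewrite -ltnS.
rewrite derivZ derivXn subSn //= scalerA -scaler_nat scalerA; congr (_ *: _).
rewrite -mulrA gbinomS natB // /w; ring.
Qed.

Lemma W_contiguity :
  'X * ('X - 1) * (W r m s)^`() = (m.+1%:R)%:P * W (r - 1) m.+1 (s - 1)
  - (s%:P * ('X - 1) + (1 + r - m%:R - s)%:P * 'X) * W r m s.
Proof.
(* For [j <= m] the coefficient of ['X^(m.+1 - j)] in [(m + 1) W'] is [v j + (r + 1 - j) * w j]. As
   [v 0 = 0] and [v j.+1] is a multiple of [w j], an index shift reduces the relation to one for
   each [w j]. *)
pose v j := j%:R * c j * gbinom (r + m%:R + 1 - j%:R + 1) (m.+1 - j).
have Ev j : (j <= m)%N -> v j.+1 = - (m%:R + s - j%:R) * w j.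
  move=> jm; rewrite /v /w /c subSS exprS.
  have -> : r + m%:R + 1 - j.+1%:R + 1 = r + m%:R + 1 - j%:R by rewrite -natr1; ring.
  have E := gbinomS (s + m%:R) j.
  by transitivity (- (-1) ^+ j * (gbinom (s + m%:R) j.+1 * j.+1%:R) *
    gbinom (r + m%:R + 1 - j%:R) (m - j)); [ring|rewrite E; ring].
apply/eqP; rewrite eq_sym subr_eq; apply/eqP.
have -> : m.+1%:R%:P * W (r - 1) m.+1 (s - 1) =
  \sum_(j < m.+1) (v j.+1) *: 'X^(m - j) + \sum_(j < m.+1) ((r + 1 - j%:R) * w j) *: 'X^(m.+1 - j).
  rewrite W'_sum mul_polyC scaler_sumr.
  have -> : \sum_(j < m.+1) v j.+1 *: 'X^(m - j) = \sum_(j < m.+2) v j *: 'X^(m.+1 - j).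
    rewrite [RHS]big_ord_recl (_ : v 0%N = 0) ?scale0r ?add0r; first exact: eq_bigr.
    by rewrite /v mulr0n !mul0r.
  rewrite [LHS]big_ord_recr [in RHS]big_ord_recr /= [RHS]addrAC -big_split /= subnn; congr (_ + _).
    apply: eq_bigr => j _; rewrite scalerA -scalerDl; congr (_ *: _).
    have jm : (j <= m)%N by rewrite -ltnS.
    have k0 : (m - j).+1%:R != 0 :> F := natr_neq0 _.
    have E1 := canRL (mulfK k0) (gbinomS (r + m%:R + 1 - j%:R) (m - j)).
    have E2 := canRL (mulfK k0) (gbinomSS (r + m%:R + 1 - j%:R) (m - j)).
    move: k0 E1 E2; rewrite -![_.+1%:R]natr1 natB // => k0.
    rewrite /v /w subSn // => -> ->; by field.
  by rewrite scalerA /v subnn !gbinom0; congr (_ *: _); ring.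
rewrite W_sum raddf_sum /= !mulr_sumr -big_split -big_split /=; apply: eq_bigr => j _.
have jm : (j <= m)%N by rewrite -ltnS.
have EX k : 'X * ('X^k)^`() = (k%:R)%:P * 'X^k :> {poly F}.
  case: k => [|k]; first by rewrite expr0 derivC mulr0 mul0r.
  by rewrite derivXn /= mulrnAr -exprS polyC_natr mulr_natl.
rewrite Ev // derivZ subSn // exprS -!mul_polyC.
transitivity (('X - 1) * (w j)%:P * ('X * ('X^(m - j))^`())
  + (s%:P * ('X - 1) + (1 + r - m%:R - s)%:P * 'X) * ((w j)%:P * 'X^(m - j))); last by ring.
rewrite EX natB //.
rewrite !(polyCM, polyCD, polyCN).
ring.
Qed.
End Binomial.

(** * Application to T, S and q *)

Section Final.
Variables (F : fieldType) (charF0 : [pchar F] =i pred0).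
Variables (r s : F) (m : nat).
Local Notation ratfun := {fraction {poly F}}.
Local Notation t := (tvar F).

Lemma gbinom_neq0 (x : F) k : (forall i, (i < k)%N -> x - i%:R != 0) -> gbinom x k != 0.
Proof.
move=> H; rewrite mulf_neq0 ?invr_neq0 //; first by apply/prodf_neq0 => i _; exact: H.
by rewrite -(prednK (fact_gt0 k)) (natr_neq0 charF0).
Qed.

Lemma topcoef_W : topcoef m (gbinom (r + m%:R + 1) m) (W r m s).
Proof.
split.
  apply: leq_trans (size_sum _ _ _) _; apply/bigmax_leqP => j _.
  by rewrite (leq_trans (size_scale_leq _ _)) // size_polyXn ltnS leq_subr.
rewrite /W coef_sum big_ord_recl big1 => [|j _]; last first.
  rewrite coefZ coefXn gtn_eqF ?mulr0 // ltn_subrL /=.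
  exact: leq_ltn_trans (leq0n _) (ltn_ord j).
by rewrite coefZ coefXn subn0 eqxx expr0 /= gbinom0 subr0 addr0 !mulr1 mul1r.
Qed.

(** Up to nonzero rational constants, the factors of the top coefficient of [W] and those produced
    by the recursion have the form [k + r] with [k > 1]. Starting at [k = 2] allows the use with
    [r - 1] in place of [r]. *)
Lemma Tn_neq0 : (forall k : nat, (1 < k)%N -> k%:R + r != 0) ->
  forall n, Tn r m s n.+1 != 0.
Proof.
move=> kr; have [sW cW] := topcoef_W.
have w0 : (W r m s)`_m != 0.
  rewrite cW; apply: gbinom_neq0 => i im.
  have -> : r + m%:R + 1 - i%:R = (m.+1 - i)%:R + r.
    by rewrite natrB ?(leq_trans (ltnW im)) // -natr1; ring.
  by rewrite kr // subSn ?ltnS ?subn_gt0 // ltnW.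
apply: toda_seq_neq0 w0 _ => [|n n0]; first by split.
have -> : (n * m)%:R + n%:R * (n.+1%:R + r) = n%:R * ((m + n.+1)%:R + r).
  by rewrite natrM natrD; ring.
rewrite mulf_neq0 // ?((pcharf0P F).1 charF0) -?lt0n //.
by apply: kr; rewrite addnS ltnS addn_gt0 n0 orbT.
Qed.

Lemma eulerD_W :
  eulerD (@derivF F) t (Tn r m s 2) = (m%:R + 1) * Sn r m s 2
  - (cst_morph F s * (t - 1) + (1 + cst_morph F r - m%:R - cst_morph F s) * t) * Tn r m s 2.
Proof.
have tX1 : t - 1 = ('X - 1)%:F by rewrite tofracB tofrac1.
have Em : m%:R + 1 = cst_morph F m.+1%:R by rewrite natr1 rmorph_nat.
have Ec : 1 + cst_morph F r - m%:R - cst_morph F s = cst_morph F (1 + r - m%:R - s).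
  by rewrite !(rmorphB, rmorph_nat) (rmorphD (cst_morph F)) rmorph1.
rewrite Em Ec /eulerD derivF_poly tX1 -(tofracM 'X) -tofracM W_contiguity //.
rewrite tofracB tofracM (tofracM _ (W r m s)) tofracD (tofracM s%:P) (tofracM _ 'X).
reflexivity.
Qed.

Lemma eulerD_W' :
  eulerD (@derivF F) t (Sn r m s 2) = (cst_morph F r + 1) * (t * (t - 1)) * Tn r m s 2.
Proof.
have Er : cst_morph F r + 1 = cst_morph F (r + 1) by rewrite rmorphD rmorph1.
rewrite Er /eulerD derivF_poly deriv_W' // (tofracM _ (W r m s)) mulrA.
by congr (_ * _); rewrite mulrC.
Qed.

Lemma qfun_pvi n : (0 < n)%N -> n%:R + r != 0 -> Sn r m s n != 0 -> Tn r m s n.+1 != 0 ->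
        m%:R + s != 0 -> r - s + 1 != 0 ->
        solves_PVI ((n%:R + r) ^+ 2 / 2) (- ((m%:R + s) ^+ 2 / 2))
                   ((r - s + 1) ^+ 2 / 2) ((1 - (n%:R + m%:R) ^+ 2) / 2)
                   (qfun r m s n).
Proof.
have ST k : Sn r m s k.+3 =
    toda (cst_morph F) (@derivF F) t (r - 1) k.+2 (Sn r m s k.+2) / Sn r m s k.+1.
  by [].
have TT k : Tn r m s k.+3 =
    toda (cst_morph F) (@derivF F) t r k.+2 (Tn r m s k.+2) / Tn r m s k.+1.
  by [].
exact: (toda_pvi charF0 (@derivFD F) (@derivFM F) (@derivF_cst_morph F) (derivF_tvar F)
  (tvar_neq0 F) (tvar_neq1 F) (erefl _) (erefl _) TT ST eulerD_W eulerD_W').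
Qed.
End Final.

Theorem mainTheorem1 (F : fieldType) (charF0 : [pchar F] =i pred0)
    (m : nat) (m_gt0 : (0 < m)%N) (r s : F) :
  [/\ forall n : nat, (0 < n)%N ->
        is_polynomial (Tn r m s n) /\ is_polynomial (Sn r m s n),
      (forall k : nat, (0 < k)%N -> k%:R + r != 0) ->
      forall n : nat, (0 < n)%N -> Tn r m s n != 0 /\ Sn r m s n != 0
    & forall n : nat, (0 < n)%N ->
        n%:R + r != 0 -> Sn r m s n != 0 -> Tn r m s n.+1 != 0 ->
        m%:R + s != 0 -> r - s + 1 != 0 ->
        solves_PVI ((n%:R + r) ^+ 2 / 2) (- ((m%:R + s) ^+ 2 / 2))
                   ((r - s + 1) ^+ 2 / 2) ((1 - (n%:R + m%:R) ^+ 2) / 2)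
                   (qfun r m s n)].
Proof.
split.
- by move=> [|n] // _; split; apply: toda_seq_polynomial.
- move=> kr [|n] // _; split; first by apply: Tn_neq0 => // k /ltnW; exact: kr.
  (* [Sn] is [Tn] at [r - 1], [m + 1], [s - 1], and [(k + 1) + (r - 1) = k + r]. *)
  apply: (@Tn_neq0 _ charF0 (r - 1) (s - 1) m.+1) => -[|k] // k0.
  by rewrite -natr1 addrACA subrr addr0 kr.
- by move=> n; apply: qfun_pvi.
Qed.
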